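(* Let $k$ be an algebraically closed field, and let $n\ge 3$ and $1\le q\le n-1$ be integers. All spaces below are considered with their reduced scheme structure. (i) If the characteristic of $k$ is different from 2, or if $q>1$, then $\mathrm{Fol}^q_0(\mathbb P^n_k)$ is isomorphic to the Grassmannian of $(q+1)$-codimensional linear subspaces of $\mathbb P^n_k$, and foliations of codimension $q$ and degree $0$ are defined by linear projections $\mathbb P^n_k\dashrightarrow\mathbb P^q_k$. (ii) If the characteristic of $k$ is 2 and $q=1$, then $\mathrm{Fol}^1_0(\mathbb P^n_k)=\mathbb P H^0(\mathbb P^n_k,\Omega^1_{\mathbb P^n_k}(2))=\mathrm{Cl}_0(\mathbb P^n_k)$. In all cases, $\mathrm{Fol}^q_0(\mathbb P^n_k)$ (with its reduced scheme structure) is a smooth and irreducible algebraic variety.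
   Context: Homogeneous polynomial $q$-forms $\omega$ on $\mathbb A^{n+1}_k$ with coefficients homogeneous of degree $d+1$ and satisfying $i_R\omega=0$, where $R=\sum_i x_i\frac{\partial}{\partial x_i}$, are identified (Euler's sequence) with elements of $H^0(\mathbb P^n_k,\Omega^q_{\mathbb P^n_k}(d+q+1))$ and called projective $q$-forms of degree $d+q+1$. Write $\mathrm{sing}(\omega)$ for the zero locus of $\omega$. The space $\mathrm{Fol}^q_d(\mathbb P^n_k)$ of codimension $q$ foliations of degree $d$ is the locally closed subscheme of $\mathbb P H^0(\mathbb P^n_k,\Omega^q_{\mathbb P^n_k}(d+q+1))$ defined by the conditions: $\mathrm{codim}\,\mathrm{sing}(\omega)\ge2$; $i_v\omega\wedge\omega=0$ for every $v\in\bigwedge^{q-1}k^{n+1}$; and $i_v\omega\wedge d\omega=0$ for every $v\in\bigwedge^{q-1}k^{n+1}$ (constant multivectors on $\mathbb A^{n+1}_k$; for $q=1$ the contraction is multiplication by scalars, so the last condition reads $\omega\wedge d\omega=0$). The foliation corresponding to $[\omega]$ has tangent sheaf the kernel of contraction with $\omega$; a foliation is defined by a linear projection $\mathbb P^n_k\dashrightarrow\mathbb P^q_k$ if its tangent sheaf is the kernel of the differential of that projection. In characteristic 2, $\mathrm{Cl}_0(\mathbb P^n_k)=\mathbb P(\{\omega\in H^0(\mathbb P^n_k,\Omega^1_{\mathbb P^n_k}(2)) : d\omega=0,\ \mathrm{codim}\,\mathrm{sing}(\omega)\ge 2\})$. *)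

(* Defs.v *)
From HB Require Import structures.
From mathcomp Require Import all_boot all_order all_algebra.
From mathcomp Require Import mpoly.

Set Implicit Arguments.
Unset Strict Implicit.
Unset Printing Implicit Defensive.

Import GRing.Theory.
Local Open Scope ring_scope.

(* Schemes of finite type over an algebraically closed field k, taken with     *)
(* their reduced structure, are represented by their sets of closed points.    *)
(* A subset of P^(N-1) is given by homogeneous coordinates, as a predicate on  *)
(* non-zero row vectors of length N that is stable under scaling.              *)

Section ProjectiveSets.
Variable k : closedFieldType.

Definition pset N := 'rV[k]_N -> Prop.

Definition same_point N (x y : 'rV[k]_N) : Prop :=
  exists2 c : k, c != 0 & y = c *: x.

Definition sub_pset N (X Y : pset N) : Prop := forall x, X x -> Y x.
Definition eq_pset N (X Y : pset N) : Prop := forall x, X x <-> Y x.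

Definition hom_poly N (p : {mpoly k[N]}) : Prop := exists d, p \is d.-homog.

Definition vanishes_on N (p : {mpoly k[N]}) (X : pset N) : Prop :=
  forall x, X x -> p.@[x 0] = 0.

Definition zclosed N (Z : pset N) : Prop :=
  exists2 S : {mpoly k[N]} -> Prop, (forall p, S p -> hom_poly p) &
    forall x, Z x <-> (x != 0 /\ forall p, S p -> p.@[x 0] = 0).

Definition locally_closed N (X : pset N) : Prop :=
  exists A B : pset N,
    [/\ zclosed A, zclosed B & forall x, X x <-> (A x /\ ~ B x)].

Definition irreducible N (X : pset N) : Prop :=
  (exists x, X x) /\
  forall A B : pset N, zclosed A -> zclosed B ->
    (forall x, X x -> A x \/ B x) -> sub_pset X A \/ sub_pset X B.

(* codim Y >= r in P^(N-1): every irreducible closed Z contained in Y starts   *)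
(* a chain of irreducible closed sets of length r (vacuous for Y empty).       *)
Definition codim_ge N (Y : pset N) (r : nat) : Prop :=
  forall Z : pset N, zclosed Z -> irreducible Z -> sub_pset Z Y ->
    exists C : nat -> pset N,
      [/\ eq_pset (C 0%N) Z,
          forall i, (i <= r)%N -> zclosed (C i) /\ irreducible (C i) &
          forall i, (i < r)%N ->
            sub_pset (C i) (C i.+1) /\ ~ sub_pset (C i.+1) (C i)].

(* A regular map is given, near each point x, by forms F_j of one degree;      *)
(* since f y is non-zero, the F_j have no common zero on X where h != 0.       *)
Definition regular_map N M (X : pset N) (Y : pset M)
    (f : 'rV[k]_N -> 'rV[k]_M) : Prop :=
  (forall x, X x -> Y (f x)) /\
  forall x, X x ->
    exists (h : {mpoly k[N]}) (e : nat) (F : 'I_M -> {mpoly k[N]}),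
      [/\ hom_poly h, h.@[x 0] != 0, forall j, F j \is e.-homog &
          forall y, X y -> h.@[y 0] != 0 ->
            same_point (f y) (\row_j (F j).@[y 0])].

Definition isomorphic N M (X : pset N) (Y : pset M) : Prop :=
  exists (f : 'rV[k]_N -> 'rV[k]_M) (g : 'rV[k]_M -> 'rV[k]_N),
    [/\ regular_map X Y f, regular_map Y X g,
        forall x, X x -> same_point x (g (f x)) &
        forall y, Y y -> same_point y (f (g y))].

(* Smoothness over k at x: on a basic open neighbourhood D(h) of x, the ideal  *)
(* sheaf of the reduced structure on X is generated by r forms f_i whose       *)
(* differentials are linearly independent at x.  The differentials kill the    *)
(* radial direction by Euler's identity, so that this may be read on the cone. *)
Definition smooth_at N (X : pset N) (x : 'rV[k]_N) : Prop :=
  exists (h : {mpoly k[N]}) (r : nat) (f : 'I_r -> {mpoly k[N]}),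
    [/\ hom_poly h /\ h.@[x 0] != 0,
        forall i, hom_poly (f i) /\ vanishes_on (f i) X,
        forall p, hom_poly p -> vanishes_on p X ->
          exists (m : nat) (g : 'I_r -> {mpoly k[N]}),
            h ^+ m * p = \sum_i g i * f i &
        row_free (\matrix_(i < r, j < N) (mderiv j (f i)).@[x 0])].

Definition smooth N (X : pset N) : Prop := forall x, X x -> smooth_at X x.

(* quasi-projective variety *)
Definition variety N (X : pset N) : Prop := locally_closed X /\ irreducible X.

End ProjectiveSets.

Section Exterior.
Variables (A : comNzRingType) (m : nat).

(* The exterior algebra of A^m: the value at J is the coefficient on e_J, the  *)
(* wedge of the e_j for j in J in increasing order.                            *)
Definition ext := {ffun {set 'I_m} -> A}.

Definition of_degree (r : nat) (a : ext) : Prop :=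
  forall J : {set 'I_m}, #|J| != r -> a J = 0.

Definition inversions (I J : {set 'I_m}) : nat :=
  #|[set p in setX I J | (p.2 < p.1)%N]|.

Definition ext1 : ext := [ffun J : {set 'I_m} => (J == set0)%:R].

Definition wedge (a b : ext) : ext :=
  [ffun K : {set 'I_m} => \sum_(I : {set 'I_m} | I \subset K)
     (-1) ^+ inversions I (K :\: I) * a I * b (K :\: I)].

Definition vec (v : 'rV[A]_m) : ext :=
  [ffun J : {set 'I_m} => \sum_(i | J == [set i]) v 0 i].

(* Contraction of a form w with a multivector v, from                          *)
(* i_(e_J) (e^J /\ e^I) = e^I for J and I disjoint.                            *)
Definition contr (v w : ext) : ext :=
  [ffun I : {set 'I_m} => \sum_(J : {set 'I_m} | [disjoint J & I])
     (-1) ^+ inversions J I * v J * w (J :|: I)].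

End Exterior.

Section Forms.
Variables (k : closedFieldType) (n : nat).

(* polynomial differential forms on A^(n+1) *)
Definition pform := ext {mpoly k[n.+1]} n.+1.

Definition ext_const (v : ext k n.+1) : pform := [ffun J => (v J)%:MP].

Definition radial : 'rV[{mpoly k[n.+1]}]_n.+1 := \row_i 'X_i.

Definition ext_d (w : pform) : pform :=
  [ffun K : {set 'I_n.+1} => \sum_(i in K)
     (-1) ^+ inversions [set i] (K :\ i) * mderiv i (w (K :\ i))].

(* projective q-forms of degree d+q+1: H^0(P^n, Omega^q(d+q+1)) *)
Definition proj_form (q d : nat) (w : pform) : Prop :=
  [/\ of_degree q w, forall I : {set 'I_n.+1}, w I \is d.+1.-homog &
      contr (vec radial) w = 0].

Definition sing (w : pform) : pset k n.+1 :=
  fun x => x != 0 /\ forall I : {set 'I_n.+1}, (w I).@[x 0] = 0.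

(* Forms with coefficients of degree at most d+1 are coordinatized by their    *)
(* coefficients; P H^0(P^n, Omega^q(d+q+1)) is a linear subspace of the        *)
(* projective space with these coordinates.                                    *)
Definition coord d := ({set 'I_n.+1} * 'X_{1..n.+1 < d.+2})%type.

Definition form_of d (c : 'rV[k]_#|{: coord d}|) : pform :=
  [ffun I : {set 'I_n.+1} => \sum_(mu : 'X_{1..n.+1 < d.+2})
     c 0 (enum_rank (I, mu)) *: 'X_[bmnm mu]].

Definition PH0 (q d : nat) : pset k #|{: coord d}| :=
  fun c => c != 0 /\ proj_form q d (form_of c).

Definition Fol (q d : nat) : pset k #|{: coord d}| :=
  fun c => let w := form_of c in
    [/\ PH0 q c, codim_ge (sing w) 2,
        forall v, of_degree q.-1 v ->
          wedge (contr (ext_const v) w) w = 0 &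
        forall v, of_degree q.-1 v ->
          wedge (contr (ext_const v) w) (ext_d w) = 0].

Definition Cl0 : pset k #|{: coord 0}| :=
  fun c => let w := form_of c in
    [/\ PH0 1 c, ext_d w = 0 & codim_ge (sing w) 2].

(* Subsheaves of T P^n that are kernels are compared on homogeneous vector     *)
(* fields: by Euler's sequence, a field v on A^(n+1) with coefficients of      *)
(* degree e represents a section of T P^n(e-1), and all sections arise so.     *)
Definition tangent_field (w : pform) (v : 'rV[{mpoly k[n.+1]}]_n.+1) : Prop :=
  contr (vec v) w = 0.

(* The projection x |-> x *m L is defined off its center x *m L = 0; its       *)
(* differential at x maps k^(n+1)/<x> to k^(q+1)/<x *m L>.                     *)
Definition in_ker_dproj q (L : 'M[k]_(n.+1, q.+1))
    (v : 'rV[{mpoly k[n.+1]}]_n.+1) : Prop :=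
  forall x : 'rV[k]_n.+1, x *m L != 0 ->
    exists c : k, map_mx (meval (x 0)) v *m L = c *: (x *m L).

Definition defined_by_linear_projection (q : nat) (w : pform) : Prop :=
  exists2 L : 'M[k]_(n.+1, q.+1), \rank L = q.+1 &
    forall (e : nat) (v : 'rV[{mpoly k[n.+1]}]_n.+1),
      (forall i, v 0 i \is e.-homog) ->
      (tangent_field w v <-> in_ker_dproj L v).

(* The Grassmannian of linear subspaces of codimension s of P^n, in its        *)
(* Pluecker embedding: the row space of U is sent to the wedge of its rows.    *)
Definition grassmannian (s : nat) : pset k #|{: {set 'I_n.+1}}| :=
  fun x => exists U : 'M[k]_(n.+1 - s, n.+1), row_free U /\
    same_point
      (\row_i (\big[@wedge k n.+1/ext1 k n.+1]_(j < n.+1 - s) vec (row j U))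
         (enum_val i)) x.

End Forms.

Arguments PH0 : clear implicits.
Arguments Fol : clear implicits.
Arguments Cl0 : clear implicits.
Arguments grassmannian : clear implicits.

(* Main.v *)
From HB Require Import structures.
Require Import Defs.
From mathcomp Require Import all_boot all_order all_algebra.
From mathcomp Require Import mpoly ring.
From Stdlib Require Import Classical.
Set Implicit Arguments.
Unset Strict Implicit.
Unset Printing Implicit Defensive.
Import GRing.Theory.
Local Open Scope ring_scope.

(** A projective q-form omega with linear coefficients is the contraction i_R eta of
    a unique constant (q+1)-form eta, by exactness of the Koszul complex ([PH0E]);
    the theorem is a statement about eta.

    The singular set of omega is the linear space of the x with i_x eta = 0, and it
    has codimension at least 2 as soon as eta is non-zero ([codim_sing]).  As
    d omega = (q+1) eta, the equations of foliations follow from the Pluecker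
    relations of eta ([plucker_integrable]).  Conversely, if q = 1 and 2 is
    invertible, omega ^ d omega = 0 gives these relations at once.  If q > 1, the
    equations i_v omega ^ omega = 0 say that all contractions i_x eta satisfy the
    Pluecker relations, and a form of degree at least 3 with this property
    satisfies them itself ([plucker_of_contractions]), in every
    characteristic.  If q = 1 and the characteristic is 2, then
    omega ^ omega = 0 and d omega = 2 eta = 0, and every eta is allowed.  Together
    this is [FolE].

    Forms satisfying the Pluecker relations are studied with the operators of
    exterior multiplication and contraction by vectors, and the Clifford relation
    between them ([clifford]).  It shows that a form killed by independent one-forms
    is divisible by their product ([evs_cvs]).  The contractions of eta by the
    multivectors e_(J minus i), for i in a set J with eta_J <> 0, are q + 1
    independent one-forms; by the Pluecker relations they kill eta, which is thus
    decomposable, and is expressed by polynomials, up to a power of eta_J, in the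
    coordinates eta_K where K differs from J in at most one element ([pl_chart],
    [pl_chart_neighbour]).

    The geometry follows.  The space of foliations is closed, being given by linear
    equations and the Pluecker relations; it is irreducible as the image of a space
    of matrices ([irreducible_param]), and smooth as it is locally the graph just
    described ([smooth_chart]).  Hodge duality turns the product of the factors of
    eta into the product of a basis of their common kernel ([star_decomposable]),
    which identifies it with the Grassmannian.  The factors are also the coordinates
    of a linear projection, and i_v i_x eta = 0 means that the images of v and x
    under it are proportional ([decomposable_cv_cv]). *)

Local Notation e_ i := (delta_mx 0 i).

(** * Signs of shuffles *)

Section Signs.
Variable m : nat.
Implicit Types (i j : 'I_m) (I J K : {set 'I_m}).

Lemma inversionsE I J :
  inversions I J = (\sum_(i in I) \sum_(j in J) (j < i)%N)%N.
Proof.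
rewrite pair_big_dep /inversions -sum1_card big_mkcond [RHS]big_mkcond /=.
apply: eq_bigr => -[i j] _; rewrite !inE /=.
by case: (i \in I); case: (j \in J); case: (j < i)%N.
Qed.

Lemma inversionsU1l i I J : i \notin I ->
  inversions (i |: I) J = (inversions [set i] J + inversions I J)%N.
Proof. by move=> iI; rewrite !inversionsE big_setU1 //= big_set1. Qed.

Lemma inversionsU1r i I J : i \notin J ->
  inversions I (i |: J) = (inversions I [set i] + inversions I J)%N.
Proof.
move=> iJ; rewrite !inversionsE -big_split; apply: eq_bigr => j _.
by rewrite /= big_setU1 //= big_set1.
Qed.

Lemma inversionsUr I J K : [disjoint J & K] ->
  inversions I (J :|: K) = (inversions I J + inversions I K)%N.
Proof.
move=> dJK; rewrite !inversionsE -big_split; apply: eq_bigr => j _.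
rewrite /= -bigU //; apply: eq_bigl => i; by rewrite in_setU.
Qed.

Lemma disjointsU1l i I J : [disjoint i |: I & J] = (i \notin J) && [disjoint I & J].
Proof. by rewrite -!setI_eq0 setIUl setU_eq0 setI_eq0 disjoints1. Qed.

Lemma disjointsU1r i I J : [disjoint I & i |: J] = (i \notin I) && [disjoint I & J].
Proof. by rewrite -!setI_eq0 setIUr setU_eq0 setIC setI_eq0 disjoints1. Qed.

Lemma inversions0l J : inversions set0 J = 0%N.
Proof. by rewrite inversionsE big_set0. Qed.

Lemma inversions0r I : inversions I set0 = 0%N.
Proof. by rewrite inversionsE big1 // => i _; rewrite big_set0. Qed.

Lemma inversions11 i j : inversions [set i] [set j] = (j < i)%N.
Proof. by rewrite inversionsE !big_set1. Qed.

Lemma inversions_swap i I : i \notin I ->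
  (inversions [set i] I + inversions I [set i] = #|I|)%N.
Proof.
move=> iI; rewrite !inversionsE big_set1 -big_split /= -sum1_card.
apply: eq_bigr => j jI; rewrite big_set1.
have : i != j by apply: contraNneq iI => ->.
by rewrite -val_eqE /=; case: ltngtP.
Qed.

End Signs.

(** * Products and contractions by vectors *)

(** The coefficients are viewed in the regular module [A^o], so that [A] acts on
    functions with values in [A] itself. *)
HB.instance Definition _ (A : comNzRingType) (m : nat) :=
  GRing.Lmodule.copy (ext A m) {ffun {set 'I_m} -> A^o}.

Section Clifford.
Variables (A : comNzRingType) (m : nat).
Implicit Types (i j : 'I_m) (I J K : {set 'I_m}) (a b x : ext A m).
Implicit Types u v w : 'rV[A]_m.

(** Exterior multiplication by a one-form and contraction by a vector, the
    creation and annihilation operators of the exterior algebra. *)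
Definition ev u x : ext A m := wedge (vec u) x.
Definition cv v x : ext A m := contr (vec v) x.
Definition pairing u v : A := \sum_i u 0 i * v 0 i.
(** The sign picked up by e_i in e_i \wedge e_K when the indices are sorted. *)
Definition sg i K : A := (-1) ^+ inversions [set i] K.

Lemma vec_set1 u i : vec u [set i] = u 0 i.
Proof.
rewrite ffunE (eq_bigl (pred1 i)) ?big_pred1_eq // => j /=.
by rewrite (inj_eq set1_inj) eq_sym.
Qed.

Lemma sum_vec (F : {set 'I_m} -> A) (P : pred {set 'I_m}) u :
  \sum_(I | P I) F I * vec u I = \sum_(i | P [set i]) F [set i] * u 0 i.
Proof.
rewrite (eq_bigr (fun I => \sum_(i | I == [set i]) F I * u 0 i)); last first.
  by move=> I _; rewrite ffunE big_distrr.
rewrite (exchange_big_dep (fun i => P [set i])) /=; last first.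
  by move=> I i PI /eqP <-.
apply: eq_bigr => i Pi; rewrite (eq_bigl (pred1 [set i])) ?big_pred1_eq // => I.
by rewrite /=; case: eqP => [->|]; rewrite ?andbF ?Pi.
Qed.

Lemma evE u x K :
  ev u x K = \sum_(i in K) sg i (K :\ i) * u 0 i * x (K :\ i).
Proof.
rewrite ffunE (eq_bigr (fun I => (-1) ^+ inversions I (K :\: I) *
  x (K :\: I) * vec u I)); last by move=> I _; rewrite mulrAC.
rewrite sum_vec; apply: eq_big => [i|i _]; first by rewrite sub1set.
by rewrite mulrAC.
Qed.

Lemma cvE v x I :
  cv v x I = \sum_(i | i \notin I) sg i I * v 0 i * x (i |: I).
Proof.
rewrite ffunE (eq_bigr (fun J => (-1) ^+ inversions J I *
  x (J :|: I) * vec v J)); last by move=> J _; rewrite mulrAC.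
rewrite sum_vec; apply: eq_big => [i|i _]; first by rewrite disjoints1.
by rewrite mulrAC.
Qed.

Lemma sg_sq i K : sg i K * sg i K = 1.
Proof. by rewrite /sg -expr2 sqrr_sign. Qed.

Lemma sgU1 i j K : j \notin K -> sg i (j |: K) = (-1) ^+ (j < i)%N * sg i K.
Proof. by move=> jK; rewrite /sg inversionsU1r // inversions11 exprD. Qed.

Lemma sg0 i : sg i set0 = 1.
Proof. by rewrite /sg inversions0r. Qed.

(** Inserting i and j in either order differs by one transposition: exactly one
    of i < j and j < i contributes an inversion. *)
Lemma sg_anti i j K : i \notin K -> j \notin K -> i != j ->
  sg i (j |: K) * sg j K = - (sg j (i |: K) * sg i K).
Proof.
move=> iK jK ij; rewrite !sgU1 //.
move: ij; rewrite -val_eqE /=; case: ltngtP => // _ _ /=;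
  rewrite ?expr0 ?expr1; ring.
Qed.

Lemma extZ c x K : (c *: x) K = c * x K.
Proof. exact: ffunE. Qed.
Lemma extD x y K : (x + y) K = x K + y K.
Proof. exact: ffunE. Qed.
Lemma extN x K : (- x) K = - x K.
Proof. exact: ffunE. Qed.
Lemma ext0 K : (0 : ext A m) K = 0.
Proof. exact: ffunE. Qed.

Lemma evD u x y : ev u (x + y) = ev u x + ev u y.
Proof.
apply/ffunP => K; rewrite extD !evE -big_split; apply: eq_bigr => i _.
by rewrite extD mulrDr.
Qed.
Lemma evZ u c x : ev u (c *: x) = c *: ev u x.
Proof.
apply/ffunP => K; rewrite extZ !evE big_distrr; apply: eq_bigr => i _.
by rewrite extZ [RHS]mulrCA.
Qed.
HB.instance Definition _ u := GRing.isLinear.Build A (ext A m) (ext A m) _ (ev u)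
  (fun c x y => etrans (evD u _ _) (congr1 (fun z => z + _) (evZ u c x))).

Lemma cvD u x y : cv u (x + y) = cv u x + cv u y.
Proof.
apply/ffunP => K; rewrite extD !cvE -big_split; apply: eq_bigr => i _.
by rewrite extD mulrDr.
Qed.
Lemma cvZ u c x : cv u (c *: x) = c *: cv u x.
Proof.
apply/ffunP => K; rewrite extZ !cvE big_distrr; apply: eq_bigr => i _.
by rewrite extZ [RHS]mulrCA.
Qed.
HB.instance Definition _ u := GRing.isLinear.Build A (ext A m) (ext A m) _ (cv u)
  (fun c x y => etrans (cvD u _ _) (congr1 (fun z => z + _) (cvZ u c x))).

Lemma evDl u v x : ev (u + v) x = ev u x + ev v x.
Proof.
apply/ffunP => K; rewrite extD !evE -big_split; apply: eq_bigr => i _.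
by rewrite mxE mulrDr mulrDl.
Qed.
Lemma evZl u c x : ev (c *: u) x = c *: ev u x.
Proof.
apply/ffunP => K; rewrite extZ !evE big_distrr; apply: eq_bigr => i _.
by rewrite mxE /= !mulrA (mulrC c).
Qed.
Lemma cvDl u v x : cv (u + v) x = cv u x + cv v x.
Proof.
apply/ffunP => K; rewrite extD !cvE -big_split; apply: eq_bigr => i _.
by rewrite mxE mulrDr mulrDl.
Qed.
Lemma cvZl u c x : cv (c *: u) x = c *: cv u x.
Proof.
apply/ffunP => K; rewrite extZ !cvE big_distrr; apply: eq_bigr => i _.
by rewrite mxE /= !mulrA (mulrC c).
Qed.
Lemma ev0l x : ev 0 x = 0.
Proof. by rewrite -(scale0r 0) evZl scale0r. Qed.
Lemma cv0l x : cv 0 x = 0.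
Proof. by rewrite -(scale0r 0) cvZl scale0r. Qed.
Lemma ev0 u : ev u 0 = 0.
Proof. exact: linear0. Qed.
Lemma cv0 u : cv u 0 = 0.
Proof. exact: linear0. Qed.
Lemma ev_suml (T : finType) (c : T -> A) (f : T -> 'rV[A]_m) x :
  ev (\sum_i c i *: f i) x = \sum_i c i *: ev (f i) x.
Proof.
rewrite (big_morph (fun u => ev u x) (fun u v => evDl u v x) (ev0l x)).
by apply: eq_bigr => i _; rewrite evZl.
Qed.
Lemma cv_suml (T : finType) (c : T -> A) (f : T -> 'rV[A]_m) x :
  cv (\sum_i c i *: f i) x = \sum_i c i *: cv (f i) x.
Proof.
rewrite (big_morph (fun u => cv u x) (fun u v => cvDl u v x) (cv0l x)).
by apply: eq_bigr => i _; rewrite cvZl.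
Qed.

Lemma cv_delta i x I :
  cv (e_ i) x I = if i \in I then 0 else sg i I * x (i |: I).
Proof.
rewrite cvE; case: ifP => iI; last first.
  rewrite (bigD1 i) ?iI //= mxE !eqxx mulr1 big1 ?addr0 // => j /andP[_ ji].
  by rewrite mxE (negPf ji) andbF mulr0 mul0r.
rewrite big1 // => j jI; rewrite mxE; case: (eqVneq j i) jI => [->|_ _]; first by rewrite iI.
by rewrite andbF mulr0 mul0r.
Qed.

Lemma cv_expand v x : cv v x = \sum_i v 0 i *: cv (e_ i) x.
Proof. by rewrite {1}[v]row_sum_delta cv_suml. Qed.

Lemma cv_delta_sq i x : cv (e_ i) (cv (e_ i) x) = 0.
Proof.
apply/ffunP => I; rewrite !cv_delta ext0; case: ifP => // _.
by rewrite setU11 mulr0.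
Qed.

Lemma cv_delta_anti i j x :
  cv (e_ i) (cv (e_ j) x) = - cv (e_ j) (cv (e_ i) x).
Proof.
have [->|ij] := eqVneq i j; first by rewrite !cv_delta_sq oppr0.
apply/ffunP => I; rewrite extN !cv_delta !in_setU1 (negPf ij) eq_sym (negPf ij) /=.
case: ifPn => iI; case: ifPn => jI; rewrite ?mulr0 ?oppr0 //.
rewrite setUCA !mulrA (mulrC (sg i I)) sg_anti // 1?eq_sym //.
by rewrite mulNr (mulrC (sg j I)).
Qed.

(** The terms that replace an index i of K by an index j outside K occur in both
    products, with opposite signs by [sg_anti].  What remains are the terms that
    remove and restore the same index: those of K come from the first product,
    the others from the second, and together they give the pairing.  All later
    results on decomposable forms are formal consequences of this relation, and
    this is why they hold in every characteristic. *)
Lemma clifford u v x : ev u (cv v x) + cv v (ev u x) = pairing u v *: x.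
Proof.
apply/ffunP => K; rewrite extD extZ evE cvE.
have E1 i : i \in K -> sg i (K :\ i) * u 0 i * cv v x (K :\ i) =
   u 0 i * v 0 i * x K + \sum_(j | j \notin K) sg i (K :\ i) * sg j (K :\ i) *
     (u 0 i * v 0 j * x (j |: (K :\ i))).
  move=> iK; rewrite cvE (bigD1 i) ?setD11 //= setD1K // mulrDr; congr (_ + _).
    by rewrite -[RHS]mul1r -(sg_sq i (K :\ i)); ring.
  rewrite big_distrr /=; apply: eq_big => [j|j _]; last by ring.
  by rewrite !inE negb_and negbK; case: (eqVneq j i) => [->|_] /=; rewrite ?iK ?andbT ?andbF.
have E2 j : j \notin K -> sg j K * v 0 j * ev u x (j |: K) =
   u 0 j * v 0 j * x K - \sum_(i in K) sg i (K :\ i) * sg j (K :\ i) *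
     (u 0 i * v 0 j * x (j |: (K :\ i))).
  move=> jK; rewrite evE big_setU1 //= setU1K // mulrDr; congr (_ + _).
    by rewrite -[RHS]mul1r -(sg_sq j K); ring.
  rewrite big_distrr -sumrN /=; apply: eq_bigr => i iK.
  have ij : j != i by apply: contraNneq jK => ->.
  have -> : (j |: K) :\ i = j |: (K :\ i).
    by apply/setP => l; rewrite !inE; case: (eqVneq l i) => // ->; rewrite eq_sym (negPf ij).
  have := @sg_anti j i (K :\ i) _ _ ij.
  rewrite !inE eqxx (negPf jK) andbF setD1K // => /(_ isT isT) H.
  set c := u 0 i * v 0 j * x (j |: K :\ i).
  transitivity (sg j K * sg i (j |: K :\ i) * c); first by rewrite /c; ring.
  rewrite -[X in X * _](mul1r) -{1}(sg_sq i (K :\ i)).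
  transitivity (sg i (K :\ i) * (sg j K * sg i (K :\ i)) * sg i (j |: K :\ i) * c).
    by ring.
  rewrite H.
  transitivity (- (sg i (j |: K :\ i) * sg i (j |: K :\ i)) *
                (sg i (K :\ i) * sg j (K :\ i) * c)); first by ring.
  by rewrite sg_sq mulN1r.
rewrite (eq_bigr _ E1) (eq_bigr _ E2) !big_split /= sumrN exchange_big /=.
rewrite addrACA addrC subrr add0r /pairing big_distrl /=.
by rewrite [RHS](bigID (mem K)).
Qed.

Lemma ev_cv u v x : ev u (cv v x) = pairing u v *: x - cv v (ev u x).
Proof. by rewrite -clifford addrK. Qed.
Lemma cv_ev u v x : cv v (ev u x) = pairing u v *: x - ev u (cv v x).
Proof. by rewrite -clifford addrC addKr. Qed.

(** The terms (i, j) and (j, i) are cancelled against each other, without a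
    division by 2, so that characteristic 2 is covered. *)
Lemma alternating_sum (V : zmodType) (F : 'I_m -> 'I_m -> V) :
  (forall i, F i i = 0) -> (forall i j, F i j = - F j i) ->
  \sum_(i < m) \sum_(j < m) F i j = 0.
Proof.
move=> F0 FN.
transitivity (\sum_(i < m) (\sum_(j < m | (i < j)%N) F i j + \sum_(j < m | (j < i)%N) F i j)).
  apply: eq_bigr => i _; rewrite (bigD1 i) //= F0 add0r (bigID (fun j : 'I_m => (i < j)%N)) /=.
  by congr (_ + _); apply: eq_bigl => j; rewrite -val_eqE /=; case: ltngtP.
rewrite big_split /= [X in _ + X](exchange_big_dep xpredT) //= -big_split big1 //= => i _.
rewrite -big_split big1 //= => j _; rewrite (FN j i) subrr //.
Qed.

Lemma cv_sq v x : cv v (cv v x) = 0.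
Proof.
rewrite [cv v x]cv_expand linear_sum /=.
transitivity (\sum_(i < m) \sum_(j < m) (v 0 i * v 0 j) *: cv (e_ j) (cv (e_ i) x)).
  apply: eq_bigr => i _; rewrite linearZ /= cv_expand scaler_sumr.
  by apply: eq_bigr => j _; rewrite scalerA.
apply: alternating_sum => [i|i j]; first by rewrite cv_delta_sq scaler0.
by rewrite cv_delta_anti scalerN mulrC.
Qed.

Lemma cv_anti u v x : cv u (cv v x) = - cv v (cv u x).
Proof.
apply/eqP; rewrite -addr_eq0; apply/eqP.
have := cv_sq (u + v) x.
by rewrite !cvDl !cvD !cv_sq add0r addr0.
Qed.

(** The coefficient at K is, up to sign, the coefficient at K minus i of the
    contraction by e_i.  Contractions thus detect forms of positive degree. *)
Lemma cv_delta_eq0 x : (forall i, cv (e_ i) x = 0) -> x set0 = 0 -> x = 0.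
Proof.
move=> H0 x0; apply/ffunP => K; rewrite ext0.
have [->//|[i iK]] := set_0Vmem K.
have /ffunP/(_ (K :\ i)) := H0 i; rewrite cv_delta setD11 setD1K // ext0.
by move/(congr1 ( *%R (sg i (K :\ i)))); rewrite mulrA sg_sq mul1r mulr0.
Qed.

Lemma ev_set0 u x : ev u x set0 = 0.
Proof. by rewrite evE big_set0. Qed.

Lemma cv_ev_sq u v x : cv v (ev u (ev u x)) = ev u (ev u (cv v x)).
Proof. by rewrite cv_ev cv_ev linearB linearZ /= opprB addrC subrK. Qed.

(** Contractions commute with the square of [ev u], so the coefficient at K of
    the square is computed after contracting x by the elements of K; one is left
    with the coefficient at the empty set, which any product by u kills. *)
Lemma ev_sq u x : ev u (ev u x) = 0.
Proof.
apply/ffunP => K; rewrite ext0.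
have [n] := ubnP #|K|; elim: n => // n IH in K x *; rewrite ltnS => leKn.
have [->|[i iK]] := set_0Vmem K; first by rewrite ev_set0.
have := IH (K :\ i) (cv (e_ i) x).
rewrite -cv_ev_sq cv_delta setD11 setD1K //.
rewrite (cardsD1 i K) iK in leKn; move=> /(_ leKn).
by move/(congr1 ( *%R (sg i (K :\ i)))); rewrite mulrA sg_sq mul1r mulr0.
Qed.

Lemma ev_anti u v x : ev u (ev v x) = - ev v (ev u x).
Proof.
apply/eqP; rewrite -addr_eq0; apply/eqP.
have := ev_sq (u + v) x.
by rewrite !evDl !evD !ev_sq add0r addr0.
Qed.

Lemma ev_degree r u x : of_degree r x -> of_degree r.+1 (ev u x).
Proof.
move=> xr K Kr; rewrite evE big1 // => i iK; rewrite xr ?mulr0 //.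
by apply: contraNneq Kr => <-; rewrite (cardsD1 i K) iK.
Qed.

Lemma cv_degree r v x : of_degree r.+1 x -> of_degree r (cv v x).
Proof.
move=> xr K Kr; rewrite cvE big1 // => i iK; rewrite xr ?mulr0 //.
by rewrite cardsU1 iK eqSS.
Qed.

Lemma degreeZ r c x : of_degree r x -> of_degree r (c *: x).
Proof. by move=> xr K Kr; rewrite extZ xr ?mulr0. Qed.
Lemma ext1_degree : of_degree 0 (ext1 A m).
Proof. by move=> K; rewrite cards_eq0 ffunE => /negPf ->. Qed.

Lemma degree0E x : of_degree 0 x -> x = x set0 *: ext1 A m.
Proof.
move=> x0; apply/ffunP => K; rewrite extZ ffunE.
by case: eqVneq => [->|K0]; rewrite ?mulr1 ?mulr0 // x0 // cards_eq0.
Qed.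

Lemma cv_degree0 v x : of_degree 0 x -> cv v x = 0.
Proof.
move=> x0; apply/ffunP => K; rewrite cvE ext0 big1 // => i iK.
by rewrite x0 ?mulr0 // cardsU1 iK.
Qed.

(** Inverse to [vec] on forms of degree 1. *)
Definition oneform x : 'rV[A]_m := \row_i x [set i].

Lemma vec_oneform x : of_degree 1 x -> vec (oneform x) = x.
Proof.
move=> x1; apply/ffunP => K; case: (boolP (#|K| == 1%N)) => [/cards1P[i ->]|K1].
  by rewrite vec_set1 mxE.
rewrite x1 // ffunE big1 // => i /eqP E; by rewrite E cards1 in K1.
Qed.

Lemma oneform_vec u : oneform (vec u) = u.
Proof. by apply/rowP => i; rewrite mxE vec_set1. Qed.

Definition ebasis J : ext A m := [ffun I => (I == J)%:R].
(** By [contr_ebasis] the contractions by basis multivectors span all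
    contractions, with coefficients in the ring. *)
Definition cJ J x : ext A m := contr (ebasis J) x.

Lemma cJE J x I :
  cJ J x I = if [disjoint J & I] then (-1) ^+ inversions J I * x (J :|: I) else 0.
Proof.
rewrite ffunE; case: ifP => dJI.
  rewrite (bigD1 J) //= ffunE eqxx mulr1 big1 ?addr0 // => K /andP[_ KJ].
  by rewrite ffunE (negPf KJ) mulr0 mul0r.
rewrite big1 // => K dK; rewrite ffunE; case: eqP => [E|]; last by rewrite mulr0 mul0r.
by rewrite E dJI in dK.
Qed.

Lemma contr_ebasis a x : contr a x = \sum_J a J *: cJ J x.
Proof.
apply/ffunP => I; rewrite ffunE sum_ffunE big_mkcond; apply: eq_bigr => J _.
rewrite extZ cJE; case: ifP => _; rewrite ?mulr0 //; by ring.
Qed.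

Lemma cJD J x y : cJ J (x + y) = cJ J x + cJ J y.
Proof. by apply/ffunP => K; rewrite extD !cJE; case: ifP; rewrite ?addr0 // extD mulrDr. Qed.
Lemma cJZ J c x : cJ J (c *: x) = c *: cJ J x.
Proof. by apply/ffunP => K; rewrite extZ !cJE; case: ifP; rewrite ?mulr0 // extZ mulrCA. Qed.
HB.instance Definition _ J := GRing.isLinear.Build A (ext A m) (ext A m) _ (cJ J)
  (fun c x y => etrans (cJD J _ _) (congr1 (fun z => z + _) (cJZ J c x))).

Lemma cJ0 x : cJ set0 x = x.
Proof. by apply/ffunP => K; rewrite cJE -setI_eq0 set0I eqxx inversions0l mul1r set0U. Qed.

Lemma cv_cJ i J x : i \notin J ->
  cv (e_ i) (cJ J x) = (-1) ^+ inversions J [set i] *: cJ (i |: J) x.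
Proof.
move=> iJ; apply/ffunP => I; rewrite cv_delta extZ !cJE.
rewrite disjointsU1l disjointsU1r iJ /=.
case: ifP => [iI|/negbT iI] /=; first by rewrite mulr0.
case: ifP => _; last by rewrite !mulr0.
rewrite inversionsU1l // inversionsU1r // !exprD /sg setUCA setUA; ring.
Qed.

Lemma cv_cJ_in i J x : i \in J -> cv (e_ i) (cJ J x) = 0.
Proof.
move=> iJ; apply/ffunP => I; rewrite cv_delta ext0 cJE disjointsU1r iJ /=.
by rewrite mulr0; case: ifP.
Qed.

Lemma cJ_cv_delta i J x : i \notin J ->
  cJ J (cv (e_ i) x) = (-1) ^+ inversions [set i] J *: cJ (i |: J) x.
Proof.
move=> iJ; apply/ffunP => I; rewrite extZ !cJE cv_delta in_setU (negPf iJ) /=.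
rewrite disjointsU1l.
case: ifP => dJI; last by rewrite andbF mulr0.
case: (boolP (i \in I)) => iI /=; first by rewrite !mulr0.
by rewrite /sg inversionsUr // inversionsU1l // !exprD setUA; ring.
Qed.

Lemma cJ_cv_delta_in i J x : i \in J -> cJ J (cv (e_ i) x) = 0.
Proof.
move=> iJ; apply/ffunP => I; rewrite ext0 !cJE cv_delta in_setU iJ /=.
by rewrite mulr0; case: ifP.
Qed.

Lemma cJ_cv J v x : cJ J (cv v x) = (-1) ^+ #|J| *: cv v (cJ J x).
Proof.
rewrite [cv v x]cv_expand [cv v (cJ J x)]cv_expand linear_sum scaler_sumr.
apply: eq_bigr => i _; rewrite linearZ /= scalerA [_ * v 0 i]mulrC -scalerA.
congr (_ *: _); have [iJ|iJ] := boolP (i \in J).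
  by rewrite cv_cJ_in // cJ_cv_delta_in // scaler0.
rewrite cv_cJ // cJ_cv_delta // scalerA -(inversions_swap iJ) exprD -mulrA.
by rewrite -expr2 sqrr_sign mulr1.
Qed.

(** Contraction by e_J is a succession of #|J| contractions by basis vectors, and
    each of these anticommutes with [ev u] because it pairs to zero with u. *)
Lemma cJ_ev J u x : (forall i, i \in J -> u 0 i = 0) ->
  cJ J (ev u x) = (-1) ^+ #|J| *: ev u (cJ J x).
Proof.
have [n] := ubnP #|J|; elim: n => // n IH in J x *; rewrite ltnS => leJn uJ.
have [->|[i iJ]] := set_0Vmem J; first by rewrite !cJ0 cards0 scale1r.
pose J' := J :\ i; have iJ' : i \notin J' by rewrite setD11.
have cardJ : #|J| = #|J'|.+1 by rewrite (cardsD1 i) iJ.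
have E y : cJ J y = (-1) ^+ inversions J' [set i] *: cv (e_ i) (cJ J' y).
  by rewrite cv_cJ // scalerA -expr2 sqrr_sign scale1r setD1K.
rewrite !E linearZ /= scalerA mulrC -scalerA; congr (_ *: _).
rewrite IH -?cardJ //; last by move=> j /setD1P[_ /uJ].
rewrite linearZ /= cv_ev (_ : pairing _ _ = 0) ?scale0r ?sub0r; last first.
  rewrite /pairing big1 // => j _; rewrite mxE.
  by case: (eqVneq j i) => [->|_]; [rewrite uJ ?mul0r|rewrite andbF mulr0].
by rewrite cardJ exprS mulN1r scaleNr scalerN.
Qed.

Lemma cJ_degree J r x : of_degree (#|J| + r) x -> of_degree r (cJ J x).
Proof.
move=> xr I Ir; rewrite cJE; case: ifP => // dJI; rewrite xr ?mulr0 //.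
by rewrite cardsU disjoint_setI0 // cards0 subn0 eqn_add2l.
Qed.

End Clifford.

(** * Products of one-forms and Pluecker relations *)

Section Decomposable.
Variables (A : comNzRingType) (m : nat).
Implicit Types (i j : 'I_m) (I J K : {set 'I_m}) (x y : ext A m).

(** The iteration starts at x rather than at 1, so that the tails met in
    inductions keep the same shape. *)
Definition evs s (u : 'I_s -> 'rV[A]_m) x : ext A m :=
  \big[@wedge A m/x]_(a < s) vec (u a).

(** The Pluecker vector of the row space of U. *)
Definition pl s (U : 'M[A]_(s, m)) : ext A m := evs (fun a => row a U) (ext1 A m).

Fixpoint cvs s : ('I_s -> 'rV[A]_m) -> ext A m -> ext A m :=
  match s return ('I_s -> 'rV[A]_m) -> ext A m -> ext A m with
  | 0%N => fun _ x => x
  | s'.+1 => fun f x => cvs (fun a : 'I_s' => f (lift ord0 a)) (cv (f ord0) x)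
  end.

Lemma evs0 (u : 'I_0 -> _) x : evs u x = x.
Proof. by rewrite /evs big_ord0. Qed.

Lemma evsS s (u : 'I_s.+1 -> _) x :
  evs u x = ev (u ord0) (evs (fun a => u (lift ord0 a)) x).
Proof. by rewrite /evs big_ord_recl. Qed.

Lemma eq_evs s (u v : 'I_s -> _) x : u =1 v -> evs u x = evs v x.
Proof. by move=> uv; rewrite /evs; apply: eq_bigr => a _; rewrite uv. Qed.

Lemma evsZ s (u : 'I_s -> _) c x : evs u (c *: x) = c *: evs u x.
Proof.
elim: s u => [|s IH] u; first by rewrite !evs0.
by rewrite !evsS IH linearZ.
Qed.

Lemma cvsZ s (v : 'I_s -> _) c x : cvs v (c *: x) = c *: cvs v x.
Proof. by elim: s v x => [|s IH] v x //=; rewrite linearZ IH. Qed.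

Lemma evs_degree s (u : 'I_s -> _) r x : of_degree r x -> of_degree (s + r) (evs u x).
Proof.
move=> xr; elim: s u => [|s IH] u; first by rewrite evs0.
by rewrite evsS; apply: ev_degree; apply: IH.
Qed.

Lemma pl_degree s (U : 'M[A]_(s, m)) : of_degree s (pl U).
Proof.
by have := evs_degree (fun a => row a U) (@ext1_degree A m); rewrite addn0.
Qed.

Lemma cvs_degree s (v : 'I_s -> _) r x : of_degree (s + r) x -> of_degree r (cvs v x).
Proof. elim: s v x => [|s IH] v x //= xr; apply: IH; exact: cv_degree. Qed.

Lemma ev_evs s (u : 'I_s -> _) a x : ev (u a) (evs u x) = 0.
Proof.
elim: s u a => [|s IH] u a; first by case: a.
rewrite evsS; case: (unliftP ord0 a) => [b|] ->; last by rewrite ev_sq.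
by rewrite ev_anti (IH (fun a => u (lift ord0 a))) ev0 oppr0.
Qed.

Lemma cv_evs s (u : 'I_s -> _) (v : 'rV[A]_m) x :
  (forall a, pairing (u a) v = 0) -> cv v x = 0 -> cv v (evs u x) = 0.
Proof.
move=> uv vx; elim: s u uv => [|s IH] u uv; first by rewrite evs0.
rewrite evsS cv_ev uv scale0r IH => [|a]; last exact: uv.
by rewrite ev0 subrr.
Qed.

Definition dual_systems s t (u v : 'I_s -> 'rV[A]_m) :=
  forall a b, pairing (u a) (v b) = if a == b then t else 0.

Lemma dual_systems_lift s t (u v : 'I_s.+1 -> 'rV[A]_m) : dual_systems t u v ->
  dual_systems t (fun a => u (lift ord0 a)) (fun a => v (lift ord0 a)).
Proof. by move=> uv a b; rewrite uv (inj_eq lift_inj). Qed.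

(** If [ev u x] vanishes, the Clifford relation reads t x = u ^ (i_v x) for a
    vector v with <u, v> = t, and i_v x is still killed by the one-forms that
    pair to zero with v.  A form killed by independent one-forms is therefore
    divisible by their product. *)
Lemma evs_cvs s t (u v : 'I_s -> _) x : dual_systems t u v ->
  (forall a, ev (u a) x = 0) -> t ^+ s *: x = evs u (cvs v x).
Proof.
elim: s u v x => [|s IH] u v x uv ux; first by rewrite evs0 scale1r.
rewrite evsS /= -IH; last 2 first.
- exact: dual_systems_lift.
- by move=> a; rewrite ev_cv ux uv /= cv0 scale0r subr0.
by rewrite linearZ /= ev_cv ux uv eqxx cv0 subr0 scalerA exprSr.
Qed.

Lemma cvs_evs s t (u v : 'I_s -> _) x : dual_systems t u v ->
  (forall a, cv (v a) x = 0) -> cvs v (evs u x) = t ^+ s *: x.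
Proof.
elim: s u v x => [|s IH] u v x uv vx; first by rewrite evs0 scale1r.
rewrite evsS /= cv_ev uv eqxx cv_evs //.
by rewrite ev0 subr0 cvsZ IH ?scalerA ?exprS //; apply: dual_systems_lift.
Qed.

Lemma pairing_delta (u : 'rV[A]_m) i : pairing u (e_ i) = u 0 i.
Proof.
rewrite /pairing (bigD1 i) //= mxE !eqxx mulr1 big1 ?addr0 // => j /negPf ji.
by rewrite mxE ji andbF mulr0.
Qed.

(** Only the existence of the sign matters below: it depends on the enumeration
    of the indices but not on x. *)
Lemma cvs_delta s (f : 'I_s -> 'I_m) : injective f -> exists e : nat,
  forall x, of_degree s x ->
    cvs (fun a => e_ (f a)) x = ((-1) ^+ e * x [set f a | a : 'I_s]) *: ext1 A m.
Proof.
suff H : injective f -> exists e : nat,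
  forall x, cvs (fun a => e_ (f a)) x set0 = (-1) ^+ e * x [set f a | a : 'I_s].
  move=> /H[e He]; exists e => x xs; rewrite -He -degree0E //.
  by apply: cvs_degree; rewrite addn0.
elim: s f => [|s IH] f f_inj.
  exists 0%N => x; rewrite expr0 mul1r; congr (x _); apply/setP => i.
  by rewrite inE; apply/esym/imsetP => -[[]].
have f'_inj : injective (fun a => f (lift ord0 a)) by move=> a b /f_inj/lift_inj.
have [e He] := IH _ f'_inj; pose J := [set f (lift ord0 a) | a : 'I_s].
exists (e + inversions [set f ord0] J)%N => x; rewrite /= He cv_delta.
have fJ : f ord0 \notin J by apply/imsetP => -[a _ /f_inj].
rewrite (negPf fJ) mulrA exprD; congr (_ * x _); apply/setP => i.
rewrite in_setU1; apply/orP/imsetP => [[/eqP ->|/imsetP[a _ ->]]|[a _ ->]].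
- by exists ord0.
- by exists (lift ord0 a).
by case: (unliftP ord0 a) => [b|] ->; [right; apply: imset_f | left].
Qed.

(** The subalgebra generated by the rows of U.  It is stable under contractions by
    the Clifford relation, and its elements of degree 1 are combinations of the
    rows; hence the one-forms obtained by contracting [pl U] are such
    combinations, which is the content of the Pluecker relations. *)
Inductive row_algebra s (U : 'M[A]_(s, m)) : ext A m -> Prop :=
| RowOne : row_algebra U (ext1 A m)
| RowAdd x y : row_algebra U x -> row_algebra U y -> row_algebra U (x + y)
| RowScale c x : row_algebra U x -> row_algebra U (c *: x)
| RowEv a x : row_algebra U x -> row_algebra U (ev (row a U) x).

Lemma pl_row_algebra s (U : 'M[A]_(s, m)) : row_algebra U (pl U).
Proof.
have H r (f : 'I_r -> 'I_s) : row_algebra U (evs (fun a => row (f a) U) (ext1 A m)).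
  elim: r f => [|r IH] f; first by rewrite evs0; constructor.
  by rewrite evsS; apply: RowEv; apply: IH.
exact: (H s id).
Qed.

Lemma cv_row_algebra s (U : 'M[A]_(s, m)) v x : row_algebra U x -> row_algebra U (cv v x).
Proof.
elim=> [|{}x y _ IHx _ IHy|c {}x _ IH|a {}x Ux IH].
- rewrite cv_degree0; last exact: ext1_degree.
  by rewrite -(scale0r (ext1 A m)); do 2!constructor.
- by rewrite linearD; apply: RowAdd.
- by rewrite linearZ; apply: RowScale.
- rewrite cv_ev -scaleN1r; apply: RowAdd; first exact: RowScale.
  by apply: RowScale; apply: RowEv.
Qed.

Lemma cJ_row_algebra s (U : 'M[A]_(s, m)) J x : row_algebra U x -> row_algebra U (cJ J x).
Proof.
have [n] := ubnP #|J|; elim: n => // n IH in J *; rewrite ltnS => leJn Ux.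
have [->|[i iJ]] := set_0Vmem J; first by rewrite cJ0.
rewrite (cardsD1 i J) iJ in leJn; rewrite -(setD1K iJ).
have := cv_cJ x (negbT (setD11 i J)).
move/(congr1 (fun z => (-1) ^+ inversions (J :\ i) [set i] *: z)).
rewrite scalerA -expr2 sqrr_sign scale1r => <-.
by apply: RowScale; apply: cv_row_algebra; apply: IH.
Qed.

Lemma oneformD x y : oneform ((x + y) : ext A m) = oneform x + oneform y.
Proof. by apply/rowP => i; rewrite !mxE extD. Qed.
Lemma oneformZ c x : oneform ((c *: x) : ext A m) = c *: oneform x.
Proof. by apply/rowP => i; rewrite !mxE extZ. Qed.
Lemma oneform0 : oneform (0 : ext A m) = 0.
Proof. by apply/rowP => i; rewrite !mxE ext0. Qed.

Lemma oneform_row_algebra s (U : 'M[A]_(s, m)) x :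
  row_algebra U x -> exists c : 'rV[A]_s, oneform x = c *m U.
Proof.
elim=> [|{}x y _ [c Hc] _ [d Hd]|c {}x _ [d Hd]|a {}x _ _].
- exists 0; rewrite mul0mx; apply/rowP => i; rewrite !mxE ffunE.
  by rewrite -cards_eq0 cards1.
- by exists (c + d); rewrite oneformD Hc Hd mulmxDl.
- by exists (c *: d); rewrite oneformZ Hd scalemxAl.
- exists (x set0 *: delta_mx 0 a); rewrite -scalemxAl -rowE.
  apply/rowP => i; rewrite !mxE evE big_set1 setDv sg0 mul1r !mxE.
  by rewrite mulrC.
Qed.

(** The one-forms i_(e_J) x span the smallest space W such that x lies in the
    exterior algebra of W; a form x of degree p is decomposable when it is killed
    by all of W. *)
Definition plucker p x := forall J, #|J|.+1 = p -> ev (oneform (cJ J x)) x = 0.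

Lemma pluckerZ p c x : plucker p x -> plucker p (c *: x).
Proof. by move=> Px J Jp; rewrite cJZ oneformZ evZl evZ Px // !scaler0. Qed.

Lemma plucker_pl p s (U : 'M[A]_(s, m)) : plucker p (pl U).
Proof.
move=> J _; have [c ->] := oneform_row_algebra (cJ_row_algebra J (pl_row_algebra U)).
rewrite mulmx_sum_row ev_suml big1 // => a _.
by rewrite (ev_evs (fun a => row a U)) scaler0.
Qed.

(** On the open set where the coordinate x_J does not vanish, the contractions of
    x by the multivectors e_(J minus i) are independent one-forms, as the
    normalization by the sign makes the block of columns J equal to x_J times the
    identity. *)
Definition chart_row J x i : 'rV[A]_m :=
  (-1) ^+ inversions (J :\ i) [set i] *: oneform (cJ (J :\ i) x).
Definition chart_mx J x : 'M[A]_(#|J|, m) :=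
  \matrix_(a < #|J|, b < m) chart_row J x (enum_val a) 0 b.

Lemma row_chart_mx J x a : row a (chart_mx J x) = chart_row J x (enum_val a).
Proof. by apply/rowP => b; rewrite !mxE. Qed.

Lemma chart_rowE J x i b : i \in J -> chart_row J x i 0 b =
  if b == i then x J else if b \in J then 0 else
  (-1) ^+ (inversions (J :\ i) [set i] + inversions (J :\ i) [set b]) * x (b |: (J :\ i)).
Proof.
move=> iJ; rewrite !mxE cJE disjoint_sym disjoints1 !inE.
have [->|bi] /= := eqVneq b i.
  by rewrite setUC setD1K // mulrA -expr2 sqrr_sign mul1r.
by case: (b \in J) => /=; rewrite ?mulr0 // mulrA exprD setUC.
Qed.

Lemma chart_dual J x : dual_systems (x J) (fun a => row a (chart_mx J x))
  (fun a : 'I_#|J| => e_ (enum_val a)).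
Proof.
move=> a b; rewrite pairing_delta row_chart_mx chart_rowE ?enum_valP //.
by rewrite (inj_eq enum_val_inj) eq_sym; case: eqP => // _; rewrite [_ \in J]enum_valP.
Qed.

Lemma enum_val_imset J : [set enum_val a | a : 'I_#|J|] = J.
Proof.
apply/setP => i; apply/imsetP/idP => [[a _ ->]|iJ]; first exact: enum_valP.
by exists (enum_rank_in iJ i); rewrite ?enum_rankK_in.
Qed.

Lemma ev_chart_row J x i : i \in J -> plucker #|J| x -> ev (chart_row J x i) x = 0.
Proof. by move=> iJ Px; rewrite evZl Px ?scaler0 // (cardsD1 i J) iJ. Qed.

Lemma ext1_eq c d : c *: ext1 A m = d *: ext1 A m -> c = d.
Proof. by move/ffunP/(_ set0); rewrite !extZ ffunE eqxx !mulr1. Qed.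

Lemma delta_ext1 i : cv (e_ i) (ext1 A m) = 0.
Proof. apply: cv_degree0; exact: ext1_degree. Qed.

(** The matrix [chart_mx J x] is dual to the basis vectors of J, up to x_J.  This
    computes the coordinate at J of its Pluecker vector, and [evs_cvs] recovers x
    from the chart as soon as x is killed by the rows. *)
Lemma pl_chart J : exists e : nat,
  (forall x, (-1) ^+ e * pl (chart_mx J x) J = x J ^+ #|J|) /\
  forall x, of_degree #|J| x ->
  (forall i, i \in J -> ev (chart_row J x i) x = 0) ->
  x J ^+ #|J| *: x = ((-1) ^+ e * x J) *: pl (chart_mx J x).
Proof.
have [e He] := @cvs_delta _ (fun a : 'I_#|J| => enum_val a) enum_val_inj.
exists e; split=> [x|x xJ rx].
  have := He _ (pl_degree (chart_mx J x)).
  rewrite (cvs_evs (chart_dual x)) => [/ext1_eq ->|a]; last exact: delta_ext1.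
  by rewrite enum_val_imset.
rewrite (evs_cvs (chart_dual x)) => [|a]; last first.
  by rewrite row_chart_mx; apply: rx; apply: enum_valP.
by rewrite He // evsZ enum_val_imset.
Qed.

(** Write E for the Pluecker vector of the chart.  Its contraction by the
    multivector e_(J minus i) is a combination of the rows of the chart, and its
    coordinates on J show that this combination is a multiple of the row of i.
    Comparing the coordinates at b gives the identity. *)
Lemma pl_chart_neighbour J x i b : i \in J -> b \notin J ->
  let E := pl (chart_mx J x) in
  x J * E (b |: (J :\ i)) = E J * x (b |: (J :\ i)).
Proof.
move=> iJ bJ E.
have [c Hc] := oneform_row_algebra (cJ_row_algebra (J :\ i) (pl_row_algebra (chart_mx J x))).
have bi : b != i by apply: contraNneq bJ => ->.
have inJ j : j \notin J :\ i -> oneform (cJ (J :\ i) E) 0 j =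
    (-1) ^+ inversions (J :\ i) [set j] * E (j |: (J :\ i)).
  by move=> jJ; rewrite mxE cJE disjoint_sym disjoints1 jJ setUC.
have cE a : c 0 a * x J = oneform (cJ (J :\ i) E) 0 (enum_val a).
  rewrite -/E in Hc; rewrite Hc mxE (bigD1 a) //= mxE chart_rowE ?enum_valP // eqxx.
  rewrite big1 ?addr0 // => a' /negPf a'a.
  by rewrite mxE chart_rowE ?enum_valP // (inj_eq enum_val_inj) eq_sym a'a mulr0.
have c0 (a : 'I_#|J|) : enum_val a != i -> c 0 a * x J = 0.
  move=> ai; rewrite cE mxE cJE disjoint_sym disjoints1 in_setD1 ai enum_valP /=.
  by [].
have := inJ b; rewrite !inE (negPf bJ) andbF => /(_ isT).
have := inJ i; rewrite !inE eqxx => /(_ isT).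
have [a Ha] : exists a : 'I_#|J|, enum_val a = i.
  by exists (enum_rank_in iJ i); rewrite enum_rankK_in.
have -> : oneform (cJ (J :\ i) E) 0 i = c 0 a * x J by rewrite cE Ha.
rewrite setD1K // => ca.
rewrite Hc mxE (bigD1 a) //= mxE chart_rowE ?enum_valP // Ha (negPf bi) (negPf bJ).
move/(congr1 (fun z => (-1) ^+ inversions (J :\ i) [set b] * (z * x J))).
rewrite mulrDl big_distrl big1 ?addr0 /= => [|a' a'a]; last first.
  by rewrite mulrAC c0 ?mul0r // -Ha (inj_eq enum_val_inj).
have -> (y z t : A) (s s' : nat) : (-1) ^+ s' * (z * ((-1) ^+ (s + s') * y) * t) =
   (-1) ^+ s * (z * t) * y * ((-1) ^+ s' * (-1) ^+ s') :> A.
  by rewrite exprD; ring.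
rewrite ca !mulrA -mulrA -!expr2 !sqrr_sign !mul1r mulr1 => ->.
by rewrite mulrC.
Qed.

Lemma cv_oneform x (v : 'rV[A]_m) : of_degree 1 x -> cv v x = pairing (oneform x) v *: ext1 A m.
Proof.
move=> x1; rewrite [LHS]degree0E; last exact: cv_degree.
congr (_ *: _); rewrite cvE /pairing; apply: eq_big => i; first by rewrite inE.
by rewrite sg0 mul1r setU0 mxE mulrC.
Qed.

Lemma pairingD (u v w : 'rV[A]_m) : pairing u (v + w) = pairing u v + pairing u w :> A.
Proof. by rewrite /pairing -big_split; apply: eq_bigr => i _; rewrite mxE mulrDr. Qed.
Lemma pairingZ (u : 'rV[A]_m) c v : pairing u (c *: v) = c * pairing u v :> A.
Proof. by rewrite /pairing big_distrr; apply: eq_bigr => i _; rewrite mxE mulrCA. Qed.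

End Decomposable.

Section Criterion.
Variables (k : fieldType) (m : nat).
Implicit Types (i j : 'I_m) (I J K : {set 'I_m}) (x y : ext k m).

Lemma ext_neq0 x : x != 0 -> exists J, x J != 0.
Proof.
move=> x0; apply/existsP; apply: contraR x0 => /existsPn x0.
by apply/eqP/ffunP => K; rewrite ext0; apply/eqP; have := x0 K; rewrite negbK.
Qed.

Lemma plucker_chart J x : of_degree #|J| x -> x J != 0 ->
  (forall i, i \in J -> ev (chart_row J x i) x = 0) ->
  exists2 c, c != 0 & x = c *: pl (chart_mx J x).
Proof.
move=> xJ xJ0 rx; have [e [_ /(_ x xJ rx)]] := pl_chart k J.
move/(congr1 (fun z => (x J ^+ #|J|)^-1 *: z)); rewrite !scalerA mulVf ?expf_neq0 //.
rewrite scale1r => E; eexists; last exact: E.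
by rewrite !mulf_neq0 ?invr_eq0 ?expf_neq0 // oppr_eq0 oner_eq0.
Qed.

(** Let J0 be a set with x_J0 <> 0.  By [plucker_chart] it is enough that x is killed
    by its contractions by e_(J0 minus a).  Let C be the contraction of x by e_B,
    where B is J0 deprived of a and of another element a', and let w and u be the contractions of C by
    X = e_a' and Y = e_a; then t = <w, Y> = - <u, X> is non-zero.  One has to show
    that z = w ^ x vanishes.  The hypothesis and its polarization give
    w ^ i_X x = 0 and w ^ i_Y x + u ^ i_X x = 0.  The vectors
    y_b = t e_b - w_b Y + u_b X pair to zero with u and w and span everything
    together with X and Y, so it is enough that they contract z, and
    D = i_Y z = t x - w ^ i_Y x, to zero.  This reduces to i_(y_b) C = 0.  Now B
    is non-empty because x has degree at least 3, the contractions by its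
    elements kill D, and so t x may be replaced by w ^ i_Y x in t i_(y_b) C; what
    comes out is a multiple of w ^ (<u, y_b> 1), which is zero. *)
Lemma plucker_of_contractions r x : of_degree r.+3 x ->
  (forall B : {set 'I_m}, #|B| = r.+1 -> forall v, ev (oneform (cv v (cJ B x))) (cv v x) = 0) ->
  plucker r.+3 x.
Proof.
move=> xr H1.
have H2 (B : {set 'I_m}) (cB : #|B| = r.+1) u v :
   ev (oneform (cv u (cJ B x))) (cv v x) + ev (oneform (cv v (cJ B x))) (cv u x) = 0.
  have := H1 B cB (u + v).
  by rewrite !cvDl oneformD evDl !evD !H1 // add0r addr0.
have [->|/ext_neq0[J0 xJ0]] := eqVneq x 0; first by move=> J _; rewrite ev0.
have cJ0 : #|J0| = r.+3 by apply/eqP; apply: contraNT xJ0 => /xr ->.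
suff rowJ0 a : a \in J0 -> ev (oneform (cJ (J0 :\ a) x)) x = 0.
  have [||c _ ->] := @plucker_chart J0 x _ xJ0.
  - by rewrite cJ0.
  - by move=> i /rowJ0 Hi; rewrite evZl Hi scaler0.
  by apply/pluckerZ/plucker_pl.
move=> aJ; have ca : #|J0 :\ a| = r.+2.
  by apply/eqP; rewrite -eqSS -cJ0 (cardsD1 a J0) aJ.
have [a' a'J] : exists a', a' \in J0 :\ a by apply/set0Pn; rewrite -card_gt0 ca.
pose B := J0 :\ a :\ a'.
have cB : #|B| = r.+1.
  by apply/eqP; rewrite -eqSS -ca (cardsD1 a' (J0 :\ a)) a'J.
have a'B : a' \notin B by rewrite setD11.
have aB : a \notin B by rewrite !inE eqxx andbF.
have [s sB] : exists s, s \in B by apply/set0Pn; rewrite -card_gt0 cB.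
pose C := cJ B x; pose X := e_ a' : 'rV[k]_m; pose Y := e_ a : 'rV[k]_m.
have C2 : of_degree 2 C by apply: cJ_degree; rewrite cB addn2.
pose w := oneform (cv X C); pose u := oneform (cv Y C).
have dC v : of_degree 1 (cv v C) by exact: cv_degree.
pose t := pairing w Y.
have wX : pairing w X = 0.
  by apply: (@ext1_eq k m); rewrite -cv_oneform // cv_sq scale0r.
have uY : pairing u Y = 0.
  by apply: (@ext1_eq k m); rewrite -cv_oneform // cv_sq scale0r.
have uX : pairing u X = - t.
  by apply: (@ext1_eq k m); rewrite scaleNr -!cv_oneform // cv_anti.
have [e He] : exists e, cJ (J0 :\ a) x = (-1) ^+ e *: cv X C.
  exists (inversions B [set a']); rewrite cv_cJ // setD1K // scalerA.
  by rewrite -expr2 sqrr_sign scale1r.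
have t0 : t != 0.
  have : cJ (J0 :\ a) x [set a] != 0.
    rewrite cJE disjoint_sym disjoints1 setD11 setUC setD1K //.
    by rewrite mulf_neq0 // signr_eq0.
  rewrite He extZ mulf_eq0 negb_or => /andP[_].
  by rewrite /t pairing_delta mxE.
pose z := ev w x.
suff z0 : z = 0 by rewrite He oneformZ evZl -/w -/z z0 scaler0.
have cXz : cv X z = 0 by rewrite cv_ev wX scale0r H1 // subr0.
have wB i : i \in B -> w 0 i = 0.
  move=> iB; rewrite -pairing_delta; apply: (@ext1_eq k m).
  by rewrite -cv_oneform // cv_anti cv_cJ_in // cv0 oppr0 scale0r.
(* w is also, up to sign, a contraction by e_s after a multivector e_B' *)
have csz : cv (e_ s) z = 0.
  rewrite cv_ev pairing_delta wB // scale0r sub0r.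
  pose B' := B :\ s.
  have sB' : s \notin B' by rewrite setD11.
  have a'B' : a' \notin B' by apply: contra a'B => /setD1P[].
  have cB' : #|a' |: B'| = r.+1.
    by rewrite cardsU1 a'B' -cB (cardsD1 s B) sB.
  have -> : w = ((-1) ^+ (inversions B' [set s]).+1 * (-1) ^+ inversions B' [set a']) *: 
      oneform (cv (e_ s) (cJ (a' |: B') x)).
    rewrite -oneformZ; congr oneform; rewrite /X /C.
    have -> : cJ B x = (-1) ^+ (inversions B' [set s]) *: cv (e_ s) (cJ B' x).
      by rewrite cv_cJ // setD1K // scalerA -expr2 sqrr_sign scale1r.
    rewrite cvZ cv_anti scalerN (cv_cJ x a'B') cvZ !scalerA exprS mulN1r.
    by rewrite mulNr scaleNr.
  by rewrite evZl H1 // scaler0 oppr0.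
pose D := t *: x - ev w (cv Y x).
have DE : cv Y z = D by rewrite cv_ev.
have csD : cv (e_ s) D = 0 by rewrite -DE cv_anti csz cv0 oppr0.
have cBD : cJ B D = 0.
  have sB' : s \notin B :\ s by rewrite setD11.
  have := cJ_cv_delta D sB'; rewrite csD linear0 setD1K // => /esym/eqP.
  by rewrite scaler_eq0 signr_eq0 /= => /eqP.
pose yb b : 'rV[k]_m := t *: e_ b + (- w 0 b *: Y + u 0 b *: X).
have wyb b : pairing w (yb b) = 0.
  by rewrite !pairingD !pairingZ pairing_delta wX -/t; ring.
have uyb b : pairing u (yb b) = 0.
  by rewrite !pairingD !pairingZ pairing_delta uX uY; ring.
have w'0 b : cv (yb b) C = 0.
  have E : t *: x = D + ev w (cv Y x) by rewrite subrK.
  have : t *: cv (yb b) C = 0.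
    rewrite -cvZ -cJZ E cJD cBD add0r cJ_ev // cvZ cv_ev wyb scale0r sub0r.
    rewrite cJ_cv cvZ -/C cv_oneform // -/u uyb scale0r scaler0 ev0.
    by rewrite oppr0 scaler0.
  by move/eqP; rewrite scaler_eq0 (negPf t0) => /eqP.
have cybz b : cv (yb b) z = 0.
  have := H2 B cB (yb b) X; rewrite -/C w'0 oneform0 ev0l add0r -/w => E.
  by rewrite cv_ev wyb scale0r E subr0.
have cbE b y : t *: cv (e_ b) y = cv (yb b) y + (w 0 b *: cv Y y - u 0 b *: cv X y).
  rewrite /yb !cvDl !cvZl scaleNr; set P := _ *: cv Y y; set Q := _ *: cv X y.
  by rewrite -addrA [- P + Q]addrC subrKA subrr addr0.
have kill y : (forall b, cv (yb b) y = 0) -> cv Y y = 0 -> cv X y = 0 ->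
    y set0 = 0 -> y = 0.
  move=> H HY HX; apply: cv_delta_eq0 => b; apply/eqP.
  have /eqP := cbE b y; rewrite H HY HX !scaler0 subrr addr0.
  by rewrite scaler_eq0 (negPf t0).
have D0 : D = 0.
  apply: kill.
  - by move=> b; rewrite -DE cv_anti cybz cv0 oppr0.
  - by rewrite -DE cv_sq.
  - by rewrite -DE cv_anti cXz cv0 oppr0.
  - by rewrite extD extZ extN ev_set0 xr ?cards0 // mulr0 subr0.
by apply: kill => //; rewrite ?DE // ev_set0.
Qed.

End Criterion.

(** * Hodge duality and decomposable forms *)

Section Star.
Variables (A : comNzRingType) (m : nat).
Implicit Types (i j : 'I_m) (I J K : {set 'I_m}) (x y : ext A m).

(** The sign makes [star] turn contractions into products, see [ev_star];
    [costar] carries the sign of the complementary shuffle and is its inverse. *)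
Definition star x : ext A m :=
  [ffun K : {set 'I_m} => (-1) ^+ inversions K (~: K) * x (~: K)].
Definition costar x : ext A m :=
  [ffun K : {set 'I_m} => (-1) ^+ inversions (~: K) K * x (~: K)].

Lemma starK x : costar (star x) = x.
Proof. by apply/ffunP => K; rewrite !ffunE setCK mulrA -expr2 sqrr_sign mul1r. Qed.
Lemma costarK x : star (costar x) = x.
Proof. by apply/ffunP => K; rewrite !ffunE setCK mulrA -expr2 sqrr_sign mul1r. Qed.

Lemma starZ c x : star (c *: x) = c *: star x.
Proof. by apply/ffunP => K; rewrite [RHS]extZ [LHS]ffunE extZ [in RHS]ffunE mulrCA. Qed.
Lemma costarZ c x : costar (c *: x) = c *: costar x.
Proof. by apply/ffunP => K; rewrite [RHS]extZ [LHS]ffunE extZ [in RHS]ffunE mulrCA. Qed.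

Lemma starD x y : star (x + y) = star x + star y.
Proof. by apply/ffunP => K; rewrite [RHS]extD !ffunE mulrDr. Qed.
Lemma costarD x y : costar (x + y) = costar x + costar y.
Proof. by apply/ffunP => K; rewrite [RHS]extD !ffunE mulrDr. Qed.

Lemma star_degree r x : (r <= m)%N -> of_degree r x -> of_degree (m - r) (star x).
Proof.
move=> rm xr K Kr; rewrite ffunE xr ?mulr0 //.
apply: contraNneq Kr => cK.
by rewrite -(eqn_add2r r) subnK // -cK cardsC card_ord.
Qed.

Lemma ev_star v x K :
  ev v (star x) K = (-1) ^+ #|K|.+1 * star (cv v x) K.
Proof.
rewrite evE ffunE cvE !big_distrr /=.
apply: eq_big => [i|i iK]; first by rewrite inE negbK.
have iK' : i \notin K :\ i by rewrite setD11.
have iC : i \notin ~: K by rewrite inE negbK.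
rewrite [star x _]ffunE; set K' := K :\ i in iK' *.
have -> : ~: K' = i |: ~: K by apply/setP => j; rewrite !inE negb_and negbK.
have -> : #|K| = #|K'|.+1 by rewrite (cardsD1 i) iK.
have -> : inversions K (~: K) = (inversions [set i] (~: K) + inversions K' (~: K))%N.
  by rewrite -{1}(setD1K iK) inversionsU1l.
rewrite inversionsU1r // -(inversions_swap iK') /sg !exprS !exprD.
set a := (-1) ^+ inversions [set i] K'; set b := (-1) ^+ inversions K' [set i].
set c := (-1) ^+ inversions K' _; set d := (-1) ^+ inversions [set i] _.
transitivity (a * b * c * v 0 i * x (i |: ~: K)); first by ring.
transitivity ((d * d) * (a * b * c * v 0 i * x (i |: ~: K))); last by ring.
by rewrite -expr2 sqrr_sign mul1r.
Qed.

Lemma ev_star0 v x : cv v x = 0 -> ev v (star x) = 0.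
Proof.
by move=> vx; apply/ffunP => K; rewrite ev_star vx ffunE !ext0 !mulr0.
Qed.

Lemma inversionsC K : (inversions K (~: K) + inversions (~: K) K = #|K| * #|~: K|)%N.
Proof.
rewrite !inversionsE [X in (_ + X)%N]exchange_big /= -big_split /=.
rewrite -sum_nat_const; apply: eq_bigr => i iK.
rewrite -big_split /= -sum1_card; apply: eq_bigr => j; rewrite inE => jK.
have : i != j by apply: contraNneq jK => <-.
by rewrite -val_eqE /=; case: ltngtP.
Qed.

Lemma costarE r x : (r <= m)%N -> of_degree r x ->
  costar x = (-1) ^+ (r * (m - r)) *: star x.
Proof.
move=> rm xr; apply/ffunP => K; rewrite [RHS]extZ !ffunE.
have [cK|cK] := eqVneq #|~: K| r; last by rewrite xr ?mulr0.
have -> : (m - r)%N = #|K| by apply/eqP; rewrite -(eqn_add2r r) subnK // -cK cardsC card_ord.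
rewrite -cK mulnC -inversionsC exprD mulrA; congr (_ * _).
by rewrite mulrAC -expr2 sqrr_sign mul1r.
Qed.

End Star.

Section Dec.
Variables (k : fieldType) (m : nat).
Implicit Types (i j : 'I_m) (I J K : {set 'I_m}) (x y : ext k m).

Definition decomposable s x :=
  exists2 U : 'M[k]_(s, m), row_free U & exists2 c, c != 0 & x = c *: pl U.

Lemma dual_row_free s t (U : 'M[k]_(s, m)) (v : 'I_s -> 'rV[k]_m) :
  t != 0 -> dual_systems t (fun a => row a U) v -> row_free U.
Proof.
move=> t0 Uv; apply/row_freeP; exists (\matrix_(i, b) (t^-1 * v b 0 i)).
apply/matrixP => a b; rewrite !mxE.
have := Uv a b; rewrite /pairing => /(congr1 ( *%R t^-1)); rewrite big_distrr /=.
have -> : t^-1 * (if a == b then t else 0) = (a == b)%:R.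
  by case: ifP; rewrite ?mulr0 ?mulVf.
by move=> <-; apply: eq_bigr => i _; rewrite !mxE mulrCA.
Qed.

Lemma pl_neq0 s (U : 'M[k]_(s, m)) : row_free U -> pl U != 0.
Proof.
case/row_freeP=> B UB; apply/eqP => U0.
have dUB : dual_systems 1 (fun a => row a U) (fun b => (col b B)^T).
  move=> a b; transitivity ((U *m B) a b); last first.
    by rewrite UB mxE; case: eqP.
  by rewrite mxE; apply: eq_bigr => i _; rewrite !mxE.
have cvs0 (v : 'I_s -> 'rV[k]_m) : cvs v 0 = 0.
  by rewrite -[RHS](scale0r (cvs v 0)) -cvsZ scale0r.
have := cvs_evs (x := ext1 k m) dUB (fun a => cv_degree0 _ (@ext1_degree k m)).
rewrite -/(pl U) U0 cvs0 expr1n scale1r => /ffunP/(_ set0).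
by rewrite ext0 ffunE eqxx => /eqP; rewrite eq_sym oner_eq0.
Qed.

Lemma decomposable_neq0 s x : decomposable s x -> x != 0.
Proof. by case=> U /pl_neq0 U0 [c c0 ->]; rewrite scaler_eq0 negb_or c0. Qed.

Lemma decomposable_degree s x : decomposable s x -> of_degree s x.
Proof. case=> U _ [c _ ->]; apply: degreeZ; exact: pl_degree. Qed.

Lemma decomposable_plucker s x : decomposable s x -> plucker s x.
Proof. by case=> U _ [c _ ->]; apply/pluckerZ/plucker_pl. Qed.

Lemma decomposableZ s c x : c != 0 -> decomposable s x -> decomposable s (c *: x).
Proof.
move=> c0 [U fU [d d0 ->]]; exists U => //; exists (c * d); first by rewrite mulf_neq0.
by rewrite scalerA.
Qed.

Lemma plucker_chart_dec p x : of_degree p x -> x != 0 -> plucker p x ->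
  exists J, [/\ #|J| = p, x J != 0, row_free (chart_mx J x) &
    exists2 c, c != 0 & x = c *: pl (chart_mx J x)].
Proof.
move=> xp /ext_neq0[J xJ] Px.
have cJ : #|J| = p by apply/eqP; apply: contraNT xJ => /xp ->.
exists J; split=> //; last first.
  apply: plucker_chart => //; rewrite ?cJ // => i iJ.
  by apply: ev_chart_row => //; rewrite cJ.
by apply: (dual_row_free xJ); apply: chart_dual.
Qed.

Lemma plucker_decomposable p x : of_degree p x -> x != 0 -> plucker p x ->
  decomposable p x.
Proof.
move=> xp x0 Px; have [J [cJ _ fJ xE]] := plucker_chart_dec xp x0 Px.
by move: fJ xE; rewrite -cJ => fJ xE; exists (chart_mx J x).
Qed.

(** Let L be the chart of x at a set J and t = x_J.  The common kernel of the rows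
    of L is spanned by the vectors u_b = t e_b - sum_(i in J) L_ib e_i, for b
    outside J.  They contract x to zero, hence multiply [star x] to zero, and
    there are as many of them as the degree of [star x]: by [evs_cvs] this form is
    a multiple of their product. *)
Lemma star_decomposable p x : (p <= m)%N -> decomposable p x ->
  decomposable (m - p) (star x).
Proof.
move=> pm dx; have x0 := decomposable_neq0 dx.
have [J [cJ xJ fJ [c c0 xE]]] :=
  plucker_chart_dec (decomposable_degree dx) x0 (decomposable_plucker dx).
have cCJ : #|~: J| = (m - p)%N by apply/eqP; rewrite -(eqn_add2l p) subnKC // -cJ cardsC card_ord.
pose u b : 'rV[k]_m := \row_j (if j == b then x J else
  if j \in J then - chart_row J x j 0 b else 0).
have ux b : b \notin J -> cv (u b) x = 0.
  move=> bJ; rewrite xE cvZ cv_evs ?scaler0 // => [a|]; last first.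
    by apply: cv_degree0; exact: ext1_degree.
  rewrite row_chart_mx; have := enum_valP a; move: (enum_val a) => i iJ.
  have bi : b != i by apply: contraNneq bJ => ->.
  have ub : u b 0 b = x J by rewrite mxE eqxx.
  have ui : u b 0 i = - chart_row J x i 0 b by rewrite [LHS]mxE eq_sym (negPf bi) iJ.
  have ri : chart_row J x i 0 i = x J by rewrite chart_rowE // eqxx.
  rewrite /pairing (bigD1 b) //= (bigD1 i) 1?eq_sym //= ub ui ri.
  rewrite big1 ?addr0 => [|j /andP[jb ji]]; first by rewrite mulrN mulrC subrr.
  rewrite [u b 0 j]mxE (negPf jb) (chart_rowE x j iJ) (negPf ji).
  by case: ifP; rewrite ?mul0r ?mulr0.
pose W : 'M[k]_(#|~: J|, m) := \matrix_(a, j) u (enum_val a) 0 j.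
have rW a : row a W = u (enum_val a) by apply/rowP => j; rewrite !mxE.
have dW : dual_systems (x J) (fun a => row a W) (fun b : 'I_#|~: J| => e_ (enum_val b)).
  move=> a b; rewrite rW pairing_delta mxE (inj_eq enum_val_inj) eq_sym.
  by have := enum_valP b; rewrite inE => /negPf ->.
rewrite -cCJ; exists W; first exact: dual_row_free dW.
have := evs_cvs (x := star x) dW _.
set y := cvs _ _ => H; have {}H : x J ^+ #|~: J| *: star x = evs (fun a => row a W) y.
  apply: H => a; rewrite rW; apply/ev_star0/ux.
  by have := enum_valP a; rewrite inE.
have y0 : of_degree 0 y.
  apply: cvs_degree; rewrite addn0 cCJ; apply: star_degree => //.
  exact: decomposable_degree.
rewrite (degree0E y0) evsZ in H.
have H' := congr1 (fun z => (x J ^+ #|~: J|)^-1 *: z) H.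
rewrite /= !scalerA mulVf ?expf_neq0 // scale1r in H'.
eexists; last exact: H'.
apply: contra x0 => /eqP c'0; rewrite -(starK x) H' c'0 scale0r.
by apply/eqP/ffunP => K; rewrite [RHS]ext0 ffunE ext0 mulr0.
Qed.

Lemma costar_decomposable p x : (p <= m)%N -> decomposable p x ->
  decomposable (m - p) (costar x).
Proof.
move=> pm dx; rewrite (costarE pm (decomposable_degree dx)).
by apply: decomposableZ; rewrite ?signr_eq0 //; apply: star_decomposable.
Qed.

(** If v kills [pl U], then so does the anticommutator of [cv v] with the product
    by a row of U, which is the multiplication by their pairing. *)
Lemma decomposable_cv s (U : 'M[k]_(s, m)) c (v : 'rV[k]_m) : row_free U -> c != 0 ->
  cv v (c *: pl U) = 0 <-> v *m U^T = 0.
Proof.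
move=> fU c0; have pE a : pairing (row a U) v = (v *m U^T) 0 a.
  by rewrite mxE; apply: eq_bigr => i _; rewrite !mxE mulrC.
split=> [/eqP|vU].
  rewrite cvZ scaler_eq0 (negPf c0) => /eqP vU; apply/rowP => a; rewrite -pE mxE.
  have := cv_ev (row a U) v (pl U).
  rewrite (ev_evs (fun a => row a U)) cv0 vU ev0 subr0 => /esym/eqP.
  by rewrite scaler_eq0 (negPf (pl_neq0 fU)) orbF => /eqP.
rewrite cvZ cv_evs ?scaler0 // => [a|]; first by rewrite pE vU mxE.
by apply: cv_degree0; exact: ext1_degree.
Qed.

(** When some factor u takes the value 1 on v, the form is u ^ i_v x, so that
    i_w i_v x = 0 yields i_w x = <u, w> i_v x: the vector w - <u, w> v contracts x
    to zero and all factors vanish on it. *)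
Lemma decomposable_cv_cv s (U : 'M[k]_(s, m)) c (v w : 'rV[k]_m) :
  row_free U -> c != 0 ->
  cv w (cv v (c *: pl U)) = 0 <->
  (v *m U^T != 0 -> exists d, w *m U^T = d *: (v *m U^T)).
Proof.
move=> fU c0; set x := c *: pl U; split=> [wvx vU|H].
  have [a va] : exists a, (v *m U^T) 0 a != 0.
    apply/existsP; apply: contraR vU => /existsPn vU.
    by apply/eqP/rowP => a; rewrite [RHS]mxE; apply/eqP; have := vU a; rewrite negbK.
  pose t := (v *m U^T) 0 a; pose u := t^-1 *: row a U.
  have uv : pairing u v = 1.
    have -> : 1 = t^-1 * pairing (row a U) v.
      by rewrite -(mulVf va) /t mxE; congr (_ * _); apply: eq_bigr => i _; rewrite !mxE mulrC.
    by rewrite /pairing big_distrr; apply: eq_bigr => i _; rewrite /u [in LHS]mxE /= -mulrA.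
  have ux : ev u x = 0 by rewrite /u evZl evZ (ev_evs (fun a => row a U)) !scaler0.
  have xE : x = ev u (cv v x) by rewrite ev_cv uv ux cv0 subr0 scale1r.
  pose d := pairing u w; exists d.
  have : cv (w - d *: v) x = 0.
    rewrite cvDl -scaleNr cvZl {1}xE cv_ev wvx ev0 subr0 scaleNr.
    exact: subrr.
  move/(decomposable_cv _ fU c0); rewrite mulmxBl => /eqP; rewrite subr_eq0 => /eqP ->.
  by rewrite -scalemxAl.
have [/(decomposable_cv _ fU c0) ->|/H[d Hd]] := eqVneq (v *m U^T) 0; first exact: cv0.
have : cv (w - d *: v) x = 0.
  by apply/(decomposable_cv _ fU c0); rewrite mulmxBl Hd -scalemxAl subrr.
move/(congr1 (cv v)); rewrite cv0 -scaleNr cvDl cvD cvZl (cvZ v) cv_sq scaler0 addr0.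
by rewrite cv_anti => /eqP; rewrite oppr_eq0 => /eqP.
Qed.

End Dec.

(** * Projective sets given by polynomial maps *)

Section Evaluation.
Variable k : closedFieldType.

Lemma digits_inj n D (a b : 'I_n -> nat) :
  (forall i, (a i < D)%N) -> (forall i, (b i < D)%N) ->
  (\sum_(i < n) a i * D ^ i = \sum_(i < n) b i * D ^ i)%N -> a =1 b.
Proof.
elim: n a b => [|n IH] a b aD bD; first by move=> _ [].
rewrite !big_ord_recl /= !expn0 !muln1.
have E (c : 'I_n.+1 -> nat) : (\sum_(i < n) c (lift ord0 i) * D ^ bump 0 i =
            (\sum_(i < n) c (lift ord0 i) * D ^ i) * D)%N.
  by rewrite big_distrl; apply: eq_bigr => i _; rewrite /= expnSr mulnA.
rewrite !E ![(_ + _ * D)%N]addnC => H.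
have D0 : (0 < D)%N by apply: leq_ltn_trans (aD ord0).
have a0 : a ord0 = b ord0.
  by have := congr1 (modn^~ D) H; rewrite !modnMDl !modn_small.
have := congr1 (divn^~ D) H; rewrite !divnMDl // !divn_small // !addn0.
move=> /IH H' i; case: (unliftP ord0 i) => [j|] -> //.
exact: H'.
Qed.

(** The polynomial is restricted to the curve z |-> (z, z^D, z^(D^2), ...), on
    which distinct monomials have distinct degrees once D exceeds all exponents.
    The resulting polynomial in z vanishes at every z, and k is infinite. *)
Lemma meval_eq0 n (p : {mpoly k[n]}) : (forall x : 'rV[k]_n, p.@[x 0] = 0) -> p = 0.
Proof.
move=> p0; pose D := (\sum_(m <- msupp p) \sum_i m i).+1.
pose deg (m : 'X_{1..n}) := (\sum_(i < n) m i * D ^ i)%N.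
pose q : {poly k} := \sum_(m <- msupp p) p@_m *: 'X^(deg m).
have suppD m i : m \in msupp p -> (m i < D)%N.
  move=> mp; rewrite ltnS (big_rem m) //= (bigD1 i) //= -addnA.
  exact: leq_addr.
have q0 : q = 0.
  apply/eqP; apply: contraT => /closed_nonrootP[z]; rewrite rootE => /negP[].
  apply/eqP; rewrite -[RHS](p0 (\row_i z ^+ (D ^ i))) mevalE.
  rewrite horner_sum; apply: eq_bigr => m _; rewrite hornerZ hornerXn; congr (_ * _).
  rewrite /deg -prodrXr; apply: eq_bigr => i _.
  by rewrite mxE -exprM mulnC.
apply/mpolyP => m; rewrite mcoeff0.
have [mp|] := boolP (m \in msupp p); last exact: memN_msupp_eq0.
have := congr1 (fun r : {poly k} => r`_(deg m)) q0; rewrite coef0 => <-.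
rewrite coef_sum (bigD1_seq m) //= coefZ coefXn eqxx mulr1 big_seq_cond big1 ?addr0 //.
move=> m' /andP[m'p m'm]; rewrite coefZ coefXn; case: eqP => [E|]; last by rewrite mulr0.
case/eqP: m'm; apply/mnmP; apply: (@digits_inj _ D) => [i|i|//]; exact: suppD.
Qed.

Lemma meval_inj n (p q : {mpoly k[n]}) :
  (forall x : 'rV[k]_n, p.@[x 0] = q.@[x 0]) -> p = q.
Proof.
move=> pq; apply/eqP; rewrite -subr_eq0; apply/eqP/meval_eq0 => x.
by rewrite mevalB pq subrr.
Qed.

Lemma homog_scale n d (p : {mpoly k[n]}) c (x : 'rV[k]_n) :
  p \is d.-homog -> p.@[(c *: x) 0] = c ^+ d * p.@[x 0].
Proof.
move=> /dhomogP pd; rewrite !mevalE big_distrr /= big_seq [RHS]big_seq.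
apply: eq_bigr => m mp; rewrite mulrCA; congr (_ * _).
have -> : d = mdeg m by rewrite -(pd m mp).
rewrite mdegE -prodrXr -big_split /=; apply: eq_bigr => i _.
by rewrite mxE exprMn.
Qed.

Definition compm n m (phi : 'I_n -> {mpoly k[m]}) (p : {mpoly k[n]}) :=
  p \mPo [tuple phi j | j < n].

Lemma meval_compm n m (phi : 'I_n -> {mpoly k[m]}) p (t : 'rV[k]_m) :
  (compm phi p).@[t 0] = p.@[(\row_j (phi j).@[t 0]) 0].
Proof.
by rewrite /compm comp_mpoly_meval; apply: meval_eq => j; rewrite tnth_mktuple mxE.
Qed.

(** Closed sets A and B that do not contain X have equations p and q that do not
    vanish identically after substitution of phi.  The ring of polynomials is a
    domain, so phi_j p(phi) q(phi) is non-zero for some j, and it does not vanish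
    at some t; then phi t is a point of X outside A and B. *)
Lemma irreducible_param N M (phi : 'I_N -> {mpoly k[M]}) (X : pset k N) :
  (exists x, X x) ->
  (forall x, X x <-> x != 0 /\
     exists t : 'rV[k]_M, same_point (\row_j (phi j).@[t 0]) x) ->
  irreducible X.
Proof.
move=> X0 XE; split=> // A B [SA homA AE] [SB homB BE] XAB.
case: (classic (sub_pset X A)) => [|nXA]; [by left | right].
apply: NNPP => nXB.
have sep (S : {mpoly k[N]} -> Prop) (C : pset k N) : (forall p, S p -> hom_poly p) ->
    (forall x, C x <-> x != 0 /\ forall p, S p -> p.@[x 0] = 0) -> ~ sub_pset X C ->
    exists p, S p /\ compm phi p != 0.
  move=> homS CE nXC; have [x nx] := not_all_ex_not _ _ nXC.
  have [Xx nCx] := imply_to_and _ _ nx.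
  have [x0 [t [c c0 xE]]] := proj1 (XE x) Xx.
  apply: NNPP => nex; apply: nCx; apply/CE; split=> // p Sp.
  have [d pd] := homS p Sp.
  rewrite xE (homog_scale _ _ pd) -meval_compm.
  have [->|p0] := eqVneq (compm phi p) 0; first by rewrite meval0 mulr0.
  by case: nex; exists p.
have [p [Sp p0]] := sep _ _ homA AE nXA.
have [q [Sq q0]] := sep _ _ homB BE nXB.
have [j phi0] : exists j, phi j != 0.
  have [x /XE[x0 [t [c c0 xE]]]] := X0.
  apply/existsP; apply: contraR x0 => /existsPn H; rewrite xE; apply/eqP/rowP => j.
  have := H j; rewrite negbK => /eqP phij.
  by rewrite !mxE phij meval0 mulr0.
suff : phi j * (compm phi p * compm phi q) = 0.
  by move/eqP; rewrite !mulf_eq0 (negPf phi0) (negPf p0) /= => q0'; case/negP: q0.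
apply: meval_eq0 => t; rewrite !mevalM !meval_compm.
set z := \row_j _; have [zj0|zj] := eqVneq (phi j).@[t 0] 0; first by rewrite zj0 mul0r.
have z0 : z != 0 by apply: contraNneq zj => /rowP/(_ j); rewrite /z !mxE => ->.
have Xz : X z.
  by apply/XE; split=> //; exists t, 1; rewrite ?oner_eq0 ?scale1r.
case: (XAB z Xz) => [/AE|/BE] [_ H]; first by rewrite (H _ Sp) mul0r mulr0.
by rewrite (H _ Sq) !mulr0.
Qed.

Definition linform N (a : 'I_N -> k) : {mpoly k[N]} := \sum_i a i *: 'X_i.

Lemma meval_linform N (a : 'I_N -> k) (x : 'I_N -> k) :
  (linform a).@[x] = \sum_i a i * x i.
Proof. by rewrite raddf_sum; apply: eq_bigr => i _; rewrite /= mevalZ mevalXU. Qed.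

Lemma linform_homog N (a : 'I_N -> k) : linform a \is 1.-homog.
Proof. by apply: rpred_sum => i _; apply: dhomogZ; rewrite dhomogX /= mdeg1. Qed.

Definition linear_pset r N (M : 'M[k]_(r, N)) : pset k N :=
  fun x => x != 0 /\ (x <= M)%MS.

Lemma linear_pset_closed r N (M : 'M[k]_(r, N)) : zclosed (linear_pset M).
Proof.
exists (fun p => exists j, p = linform (fun i => cokermx M i j)).
  by move=> _ [j ->]; exists 1%N; apply: linform_homog.
move=> x; rewrite /linear_pset submxE; split=> [][x0 H]; split=> //.
  move=> _ [j ->]; rewrite meval_linform.
  have /rowP/(_ j) := eqP H; rewrite [LHS]mxE [RHS]mxE => E; rewrite -[RHS]E.
  by apply: eq_bigr => i _; rewrite mulrC.
apply/eqP/rowP => j; rewrite [LHS]mxE [RHS]mxE -[RHS](H _ (ex_intro _ j erefl)) meval_linform.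
by apply: eq_bigr => i _; rewrite mulrC.
Qed.

Lemma linear_pset_irreducible r N (M : 'M[k]_(r, N)) : M != 0 ->
  irreducible (linear_pset M).
Proof.
move=> M0.
have phiE (t : 'rV[k]_r) : \row_j (linform (fun a => M a j)).@[t 0] = t *m M.
  apply/rowP => j; rewrite [LHS]mxE [RHS]mxE meval_linform.
  by apply: eq_bigr => i _; rewrite mulrC.
apply: (@irreducible_param _ _ (fun j => linform (fun a => M a j))) => [|x].
  have [i Mi] : exists i, row i M != 0.
    apply/existsP; apply: contraR M0 => /existsPn H.
    by apply/eqP/row_matrixP => i; have := H i; rewrite negbK row0 => /eqP.
  by exists (row i M); split=> //; apply: row_sub.
split=> [][x0].
  case/submxP=> t xE; split=> //.
  by exists t, 1; rewrite ?oner_eq0 // phiE scale1r.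
by case=> t [c c0]; rewrite phiE => xE; split=> //; rewrite xE scalemx_sub ?submxMl.
Qed.

Definition in_ideal N r (f : 'I_r -> {mpoly k[N]}) q := exists g, q = \sum_i g i * f i.

Section Ideal.
Variables (N r : nat) (f : 'I_r -> {mpoly k[N]}).
Lemma in_ideal0 : in_ideal f 0.
Proof. by exists (fun=> 0); rewrite big1 // => i _; rewrite mul0r. Qed.
Lemma in_idealD p q : in_ideal f p -> in_ideal f q -> in_ideal f (p + q).
Proof.
move=> [g ->] [h ->]; exists (fun i => g i + h i); rewrite -big_split.
by apply: eq_bigr => i _; rewrite mulrDl.
Qed.
Lemma in_idealM p q : in_ideal f q -> in_ideal f (p * q).
Proof.
move=> [h ->]; exists (fun i => p * h i); rewrite big_distrr.
by apply: eq_bigr => i _; rewrite /= mulrA.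
Qed.
Lemma in_ideal_gen i : in_ideal f (f i).
Proof.
exists (fun j => (j == i)%:R); rewrite (bigD1 i) //= eqxx mul1r big1 ?addr0 // => j /negPf ->.
by rewrite mul0r.
Qed.
Lemma in_ideal_subM p p' q q' : in_ideal f (p - p') -> in_ideal f (q - q') ->
  in_ideal f (p * q - p' * q').
Proof.
move=> Hp Hq; have -> : p * q - p' * q' = q * (p - p') + p' * (q - q') by ring.
by apply: in_idealD; apply: in_idealM.
Qed.

Lemma in_ideal_compm M (u v : 'I_M -> {mpoly k[N]}) p :
  (forall j, in_ideal f (u j - v j)) -> in_ideal f (compm u p - compm v p).
Proof.
move=> uv; rewrite /compm !comp_mpolyE -sumrB.
apply: (big_ind (in_ideal f)); [exact: in_ideal0 | exact: in_idealD|].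
move=> m _; rewrite -scalerBr -mul_mpolyC; apply: in_idealM.
apply: (big_rec2 (fun a b => in_ideal f (a - b))) => [|j a b _ ab].
  by rewrite subrr; apply: in_ideal0.
apply: in_ideal_subM ab; rewrite !tnth_mktuple.
elim: (m j) => [|e IH]; first by rewrite subrr; apply: in_ideal0.
by rewrite !exprS; apply: in_ideal_subM.
Qed.
End Ideal.

(** On the open set where h does not vanish, X is the graph of F / h^e over the
    coordinates in D.  The forms h^e X_j - F_j, for j outside D, have the Jacobian
    matrix h^e times the identity in the columns outside D.  A form p of degree d
    that vanishes on X satisfies p(F) = 0, and h^(e d) p = p(h^e X) is congruent
    to p(F) modulo these forms. *)
Lemma smooth_chart N (X : pset k N) x (h : {mpoly k[N]}) b e
    (F : 'I_N -> {mpoly k[N]}) (D : {set 'I_N}) :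
  X x -> h \is b.-homog -> h.@[x 0] != 0 ->
  (forall j, F j \is (b * e + 1).-homog) ->
  (forall j, j \in D -> F j = h ^+ e * 'X_j) ->
  (forall l, l \notin D -> mderiv l h = 0) ->
  (forall j l, l \notin D -> mderiv l (F j) = 0) ->
  (forall y, X y -> forall j, (F j).@[y 0] = h.@[y 0] ^+ e * y 0 j) ->
  (forall y : 'rV_N, \row_j (F j).@[y 0] != 0 -> X (\row_j (F j).@[y 0])) ->
  smooth_at X x.
Proof.
move=> Xx hh hx Fh FD dh dF FX XF.
pose G j := h ^+ e * 'X_j - F j.
have cl (i : 'I_#|~: D|) : enum_val i \notin D by have := enum_valP i; rewrite inE.
exists h, #|~: D|, (fun i => G (enum_val i)); split.
- by split=> //; exists b.
- move=> i; split.
    have hX : h ^+ e * 'X_(enum_val i) \is (b * e + 1).-homog.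
      by apply: dhomogM; [exact: dhomogMn | rewrite dhomogX /= mdeg1].
    exists (b * e + 1)%N; exact: rpredB hX (Fh _).
  move=> y Xy; rewrite mevalB mevalM rmorphXn mevalXU FX //.
  exact: subrr.
- move=> p [d pd] pX; exists (e * d)%N.
  suff -> : h ^+ (e * d) * p = compm (fun j => h ^+ e * 'X_j) p - compm F p.
    apply: in_ideal_compm => j; have [jD|jD] := boolP (j \in D).
      by rewrite FD // subrr; apply: in_ideal0.
    have jC : j \in ~: D by rewrite inE.
    have -> : h ^+ e * 'X_j - F j = G (enum_val (enum_rank_in jC j)).
      by rewrite enum_rankK_in.
    exact: (in_ideal_gen (fun i : 'I_#|~: D| => G (enum_val i))).
  have -> : compm F p = 0.
    apply: meval_eq0 => y; rewrite meval_compm; set z := \row_j _.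
    have [z0|/XF/pX//] := eqVneq z 0.
    by rewrite z0 -(scale0r x) (homog_scale _ _ pd) pX // mulr0.
  rewrite subr0; apply: meval_inj => y; rewrite meval_compm mevalM rmorphXn.
  have -> : \row_j (h ^+ e * 'X_j).@[y 0] = (h.@[y 0] ^+ e) *: y.
    by apply/rowP => j; rewrite !mxE mevalM rmorphXn mevalXU.
  by rewrite (homog_scale _ _ pd) exprM.
- apply/row_freeP; exists (\matrix_(j, i) if j == enum_val i then (h.@[x 0] ^+ e)^-1 else 0).
  apply/matrixP => i i'; rewrite !mxE (bigD1 (enum_val i')) //= big1 => [|j ji]; last first.
    by rewrite !mxE (negPf ji) mulr0.
  rewrite addr0 !mxE eqxx mderivB mderivM dF // subr0.
  have -> : mderiv (enum_val i') (h ^+ e) = 0.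
    elim: {+}e => [|e' IH]; first by rewrite expr0 -mpolyC1 mderivC.
    by rewrite exprS mderivM IH dh // mul0r mulr0 addr0.
  rewrite mul0r add0r mevalM rmorphXn mderivX mnm1E.
  rewrite (inj_eq enum_val_inj); have [->|_] := eqVneq i i'; last first.
    by rewrite scale0r meval0 mulr0 mul0r.
  have -> : (U_(enum_val i') - U_(enum_val i'))%MM = 0%MM :> 'X_{1..N}.
    by apply/mnmP => l; rewrite mnmBE subnn mnm0E.
  by rewrite mpolyX0 scale1r meval1 mulr1 mulfV // expf_neq0.
Qed.

End Evaluation.

(** * Change of coefficient ring *)

Section BaseChange.
Variables (A B : comNzRingType) (m : nat) (f : {rmorphism A -> B}).
Implicit Types (x y : ext A m) (J : {set 'I_m}).

Definition map_ext x : ext B m := [ffun K => f (x K)].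

Lemma map_extE x K : map_ext x K = f (x K).
Proof. exact: ffunE. Qed.

Lemma map_ext_ev u x : map_ext (ev u x) = ev (map_mx f u) (map_ext x).
Proof.
apply/ffunP => K; rewrite map_extE !evE rmorph_sum; apply: eq_bigr => i _.
by rewrite !rmorphM /sg rmorph_sign mxE map_extE.
Qed.

Lemma map_ext_cv v x : map_ext (cv v x) = cv (map_mx f v) (map_ext x).
Proof.
apply/ffunP => K; rewrite map_extE !cvE rmorph_sum; apply: eq_bigr => i _.
by rewrite !rmorphM /sg rmorph_sign mxE map_extE.
Qed.

Lemma map_ext_cJ J x : map_ext (cJ J x) = cJ J (map_ext x).
Proof.
apply/ffunP => K; rewrite map_extE !cJE; case: ifP => _; last by rewrite rmorph0.
by rewrite rmorphM rmorph_sign map_extE.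
Qed.

Lemma map_ext1 : map_ext (ext1 A m) = ext1 B m.
Proof. by apply/ffunP => K; rewrite map_extE !ffunE rmorph_nat. Qed.

Lemma map_oneform x : oneform (map_ext x) = map_mx f (oneform x).
Proof. by apply/rowP => i; rewrite !mxE map_extE. Qed.

Lemma map_ext_pl s (U : 'M[A]_(s, m)) : map_ext (pl U) = pl (map_mx f U).
Proof.
rewrite /pl -map_ext1; elim: s U => [|s IH] U; first by rewrite !evs0.
rewrite !evsS map_ext_ev map_row; congr (ev _ _).
have rE (R : comNzRingType) (V : 'M[R]_(s.+1, m)) (y : ext R m) :
    evs (fun a => row (lift ord0 a) V) y = evs (fun a => row a (row' ord0 V)) y.
  by apply: eq_evs => a; apply/rowP => j; rewrite !mxE.
by rewrite !rE IH; apply: eq_evs => a; apply/rowP => j; rewrite !mxE.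
Qed.

Lemma map_chart_mx J x : chart_mx J (map_ext x) = map_mx f (chart_mx J x).
Proof.
apply/matrixP => a b; rewrite !mxE -map_ext_cJ map_extE rmorphM rmorph_sign.
by [].
Qed.

Lemma map_ext_plucker p x : plucker p x -> plucker p (map_ext x).
Proof.
move=> Px J Jp; rewrite -map_ext_cJ map_oneform -map_ext_ev Px //.
by apply/ffunP => K; rewrite map_extE !ext0 rmorph0.
Qed.

Lemma map_ext_degree r x : of_degree r x -> of_degree r (map_ext x).
Proof. by move=> xr K Kr; rewrite map_extE xr // rmorph0. Qed.

End BaseChange.

Section Wedge.
Variables (A : comNzRingType) (m : nat).

Lemma wedge_suml (T : finType) (c : T -> A) (x : T -> ext A m) (y : ext A m) :
  wedge (\sum_t c t *: x t) y = \sum_t c t *: wedge (x t) y.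
Proof.
apply/ffunP => K; rewrite ffunE sum_ffunE.
under [RHS]eq_bigr => t _ do rewrite extZ ffunE big_distrr /=.
rewrite exchange_big; apply: eq_bigr => I _ /=; rewrite sum_ffunE big_distrr big_distrl /=.
by apply: eq_bigr => t _; rewrite extZ; ring.
Qed.

Lemma ev_ext1 u : ev u (ext1 A m) = vec u.
Proof.
rewrite -[RHS]vec_oneform; last first.
  by move=> K K1; rewrite ffunE big1 // => i /eqP E; rewrite E cards1 in K1.
apply/ffunP => K; have [/cards1P[i ->]|K1] := boolP (#|K| == 1%N); last first.
  rewrite (ev_degree _ (@ext1_degree A m)) // ffunE big1 // => i /eqP E.
  by rewrite E cards1 in K1.
rewrite evE big_set1 setDv sg0 mul1r ffunE eqxx mulr1.
by rewrite oneform_vec vec_set1.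
Qed.

Lemma wedge_oneform (x y : ext A m) : of_degree 1 x -> wedge x y = ev (oneform x) y.
Proof. by move=> x1; rewrite /ev vec_oneform. Qed.

Lemma oneform_sum (T : finType) (c : T -> A) (x : T -> ext A m) :
  oneform (\sum_t c t *: x t : ext A m) = \sum_t c t *: oneform (x t).
Proof.
apply/rowP => i; rewrite mxE sum_ffunE summxE; apply: eq_bigr => t _.
by rewrite extZ !mxE.
Qed.

End Wedge.

(** * Forms with linear coefficients as contractions of constant forms *)

Section Coordinates.
Variable n : nat.
Local Notation N := #|{: Defs.coord n 0}|.

Lemma bounded_unit_subproof (i : 'I_n.+1) : (mdeg U_(i)%MM < 2)%N.
Proof. by rewrite mdeg1. Qed.
Definition bunit (i : 'I_n.+1) : 'X_{1..n.+1 < 2} := BMultinom (bounded_unit_subproof i).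

Lemma bunit_inj : injective bunit.
Proof.
move=> i j /(congr1 (@bmnm _ _))/mnmP/(_ i) /=; rewrite !mnm1E eqxx.
by case: eqP.
Qed.

(** The index of the coefficient of x_i dx_I. *)
Definition cidx (I : {set 'I_n.+1}) (i : 'I_n.+1) : 'I_N :=
  enum_rank ((I, bunit i) : Defs.coord n 0).

(** The coordinates of the contraction of the constant form x by the radial field,
    see [form_of_to_coord]: the coefficient of x_i dx_I is that of dx_I in i_(e_i) x. *)
Definition to_coord (A : comNzRingType) (x : ext A n.+1) : 'rV[A]_N :=
  \row_j \sum_i (if (enum_val j : Defs.coord n 0).2 == bunit i
                 then cv (e_ i) x (enum_val j : Defs.coord n 0).1 else 0).

(** An element of K; the value [ord0] is taken only when K is empty. *)
Definition some_elt (K : {set 'I_n.+1}) : 'I_n.+1 := odflt ord0 [pick i in K].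

Lemma some_eltP (K : {set _}) i : i \in K -> some_elt K \in K.
Proof. by rewrite /some_elt; case: pickP => //= K0; rewrite K0. Qed.

(** Among the coordinates that carry the coefficient of a constant form at K, up
    to sign, one is singled out. *)
Definition kappa (K : {set 'I_n.+1}) : 'I_N := cidx (K :\ some_elt K) (some_elt K).

Definition of_coord (A : comNzRingType) q (c : 'rV[A]_N) : ext A n.+1 :=
  [ffun K : {set 'I_n.+1} => if #|K| == q.+1 then
     sg A (some_elt K) (K :\ some_elt K) * c 0 (kappa K) else 0].

Lemma to_coord_cidx (A : comNzRingType) (x : ext A n.+1) I i :
  to_coord x 0 (cidx I i) = cv (e_ i) x I.
Proof.
rewrite mxE enum_rankK /= (bigD1 i) //= eqxx big1 ?addr0 // => j ji.
by rewrite (inj_eq bunit_inj) eq_sym (negPf ji).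
Qed.

Lemma of_coord_degree (A : comNzRingType) q (c : 'rV[A]_N) : of_degree q.+1 (of_coord q c).
Proof. by move=> K /negPf K0; rewrite ffunE K0. Qed.

Lemma to_coordK (A : comNzRingType) q (x : ext A n.+1) :
  of_degree q.+1 x -> of_coord q (to_coord x) = x.
Proof.
move=> xq; apply/ffunP => K; rewrite ffunE; case: eqP => [cK|/eqP/xq -> //].
have [i iK] : exists i, i \in K by apply/set0Pn; rewrite -card_gt0 cK.
have eK := some_eltP iK; rewrite to_coord_cidx cv_delta setD11 setD1K //.
by rewrite mulrA sg_sq mul1r.
Qed.

Lemma to_coordZ (A : comNzRingType) c (x : ext A n.+1) : to_coord (c *: x) = c *: to_coord x.
Proof.
apply/rowP => j; rewrite !mxE big_distrr; apply: eq_bigr => i _ /=.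
by case: ifP; rewrite ?mulr0 // cvZ extZ.
Qed.

Lemma to_coord0 (A : comNzRingType) : to_coord (0 : ext A n.+1) = 0.
Proof. by rewrite -(scale0r (0 : ext A n.+1)) to_coordZ scale0r. Qed.

Lemma of_coordZ (A : comNzRingType) q c (x : 'rV[A]_N) : of_coord q (c *: x) = c *: of_coord q x.
Proof.
apply/ffunP => K; rewrite extZ !ffunE; case: ifP; rewrite ?mulr0 // mxE.
by rewrite mulrCA.
Qed.

Lemma to_coordD (A : comNzRingType) (x y : ext A n.+1) :
  to_coord (x + y) = to_coord x + to_coord y.
Proof.
apply/rowP => j; rewrite !mxE -big_split; apply: eq_bigr => i _ /=.
by case: ifP; rewrite ?addr0 // cvD extD.
Qed.

Lemma of_coordD (A : comNzRingType) q (c d : 'rV[A]_N) :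
  of_coord q (c + d) = of_coord q c + of_coord q d.
Proof.
by apply/ffunP => K; rewrite extD !ffunE; case: ifP; rewrite ?addr0 // mxE mulrDr.
Qed.

Lemma map_to_coord (A B : comNzRingType) (f : {rmorphism A -> B}) x :
  map_mx f (to_coord x) = to_coord (map_ext f x).
Proof.
apply/rowP => j; rewrite !mxE rmorph_sum; apply: eq_bigr => i _.
case: ifP => _; last by rewrite rmorph0.
by rewrite -[LHS]map_extE map_ext_cv map_delta_mx.
Qed.

Lemma map_of_coord (A B : comNzRingType) (f : {rmorphism A -> B}) q c :
  map_ext f (of_coord q c) = of_coord q (map_mx f c).
Proof.
apply/ffunP => K; rewrite map_extE !ffunE; case: ifP => _; last by rewrite rmorph0.
by rewrite rmorphM rmorph_sign mxE.
Qed.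

End Coordinates.

Section Forms.
Variables (k : closedFieldType) (n : nat).
Local Notation N := #|{: Defs.coord n 0}|.
Implicit Types (x : ext k n.+1) (c : 'rV[k]_N).
Local Notation const := (map_ext (@mpolyC n.+1 k)).
Local Notation rad := (radial k n).

Definition radial_form x : pform k n := cv rad (const x).

Lemma map_meval_const (a : 'rV[k]_n.+1) x : map_ext (meval (a 0)) (const x) = x.
Proof. by apply/ffunP => K; rewrite !map_extE /= mevalC. Qed.

Lemma map_meval_radial (a : 'rV[k]_n.+1) : map_mx (meval (a 0)) rad = a.
Proof. by apply/rowP => i; rewrite !mxE mevalXU. Qed.

Lemma meval_radial_form (a : 'rV[k]_n.+1) x :
  map_ext (meval (a 0)) (radial_form x) = cv a x.
Proof. by rewrite map_ext_cv map_meval_const map_meval_radial. Qed.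

Lemma radial_formE x I : radial_form x I = \sum_i cv (e_ i) x I *: 'X_i.
Proof.
rewrite /radial_form cv_expand sum_ffunE; apply: eq_bigr => i _.
rewrite extZ mxE mulrC -mul_mpolyC; congr (_ * _).
by rewrite -[RHS]map_extE map_ext_cv map_delta_mx.
Qed.

Lemma form_of_to_coord x : form_of (to_coord x) = radial_form x.
Proof.
apply/ffunP => I; rewrite radial_formE ffunE.
under eq_bigr => mu _ do rewrite mxE enum_rankK /= scaler_suml.
rewrite exchange_big; apply: eq_bigr => i _ /=.
rewrite (bigD1 (bunit i)) //= eqxx big1 ?addr0 // => mu /negPf ->.
by rewrite scale0r.
Qed.

Lemma meval_form_inj (w w' : pform k n) :
  (forall a : 'rV[k]_n.+1, map_ext (meval (a 0)) w = map_ext (meval (a 0)) w') -> w = w'.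
Proof.
move=> H; apply/ffunP => K; apply: meval_inj => a.
by have /ffunP/(_ K) := H a; rewrite !map_extE.
Qed.

Lemma radial_form_degree q x : of_degree q.+1 x -> of_degree q (radial_form x).
Proof. by move=> xq; apply: cv_degree; apply: map_ext_degree. Qed.

Lemma radial_form_proj q x : of_degree q.+1 x -> proj_form q 0 (radial_form x).
Proof.
move=> xq; split; first exact: radial_form_degree.
  by move=> I; rewrite radial_formE; apply: linform_homog.
exact: cv_sq.
Qed.

(** Exactness of the Koszul complex for linear coefficients.  Write the form as
    sum_i x_i om_i with constant om_i.  Its contraction by the radial field is
    quadratic in x; that it vanishes means that i_(e_i) om_i = 0 and
    i_(e_i) om_j = - i_(e_j) om_i.  These relations make the coefficient of om_i at K minus i independent of i in
    K, up to the expected sign, and this common value defines a constant form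
    whose contraction by e_i is om_i. *)
Lemma PH0E q c : PH0 k n q 0 c <-> c != 0 /\ c = to_coord (of_coord q c).
Proof.
split=> [[c0 [wq wh wR]]|[c0 cE]]; last first.
  split=> //; rewrite cE form_of_to_coord; apply: radial_form_proj.
  exact: of_coord_degree.
split=> //.
have coefE I (mu : 'X_{1..n.+1 < 2}) : (form_of c I)@_mu = c 0 (enum_rank (I, mu)).
  rewrite ffunE raddf_sum (bigD1 mu) //= mcoeffZ mcoeffX eqxx mulr1 big1 ?addr0 //.
  move=> nu /negPf numu; rewrite mcoeffZ mcoeffX.
  by rewrite -bmeqP numu mulr0.
have c_nonlin I (mu : 'X_{1..n.+1 < 2}) : mdeg mu != 1%N -> c 0 (enum_rank (I, mu)) = 0.
  by move=> mu1; rewrite -coefE (dhomog_nemf_coeff (wh I)).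
have c_lin (mu : 'X_{1..n.+1 < 2}) : mdeg mu = 1%N -> exists i, mu = bunit i.
  by move/eqP/mdeg1P => [i /eqP E]; exists i; apply: val_inj; rewrite /= E.
pose om i : ext k n.+1 := [ffun I => c 0 (cidx I i)].
have om_degree i : of_degree q (om i).
  by move=> I Iq; rewrite ffunE -coefE wq // mcoeff0.
have wE : form_of c = \sum_i 'X_i *: const (om i).
  apply/ffunP => I; rewrite ffunE sum_ffunE.
  rewrite (bigID (fun mu : 'X_{1..n.+1 < 2} => mdeg mu == 1%N)) /=.
  rewrite [X in _ + X]big1 => [|mu mu1]; last first.
    by rewrite c_nonlin // scale0r.
  rewrite addr0.
  transitivity (\sum_i \sum_(mu : 'X_{1..n.+1 < 2} | mu == bunit i)
      c 0 (enum_rank (I, mu)) *: 'X_[mu] : {mpoly k[n.+1]}).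
    rewrite (exchange_big_dep (fun mu : 'X_{1..n.+1 < 2} => mdeg mu == 1%N)) /=; last first.
      by move=> i mu _ /eqP ->; rewrite mdeg1.
    apply: eq_bigr => mu /eqP/c_lin[i ->].
    rewrite (eq_bigl (pred1 i)) ?big_pred1_eq // => j.
    by rewrite /= (inj_eq (@bunit_inj n)) eq_sym.
  apply: eq_bigr => i _; rewrite big_pred1_eq extZ map_extE ffunE.
  by rewrite mulrC mul_mpolyC.
have omR (a : 'rV[k]_n.+1) : cv a (\sum_i a 0 i *: om i) = 0.
  have := congr1 (map_ext (meval (a 0))) (wR : cv rad (form_of c) = 0).
  rewrite map_ext_cv map_meval_radial wE.
  have -> : map_ext (meval (a 0)) (\sum_i 'X_i *: const (om i)) = \sum_i a 0 i *: om i.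
    apply/ffunP => K; rewrite map_extE !sum_ffunE rmorph_sum; apply: eq_bigr => i _.
    by rewrite !extZ rmorphM /= mevalXU map_extE mevalC.
  by move=> ->; apply/ffunP => K; rewrite map_extE !ext0 rmorph0.
have sum_delta i : \sum_j (e_ i : 'rV[k]_n.+1) 0 j *: om j = om i.
  rewrite (bigD1 i) //= mxE !eqxx scale1r big1 ?addr0 // => j /negPf ji.
  by rewrite mxE ji andbF scale0r.
have om_ii i : cv (e_ i) (om i) = 0 by have := omR (e_ i); rewrite sum_delta.
have om_ij i j : cv (e_ i) (om j) = - cv (e_ j) (om i).
  apply/eqP; rewrite -addr_eq0; apply/eqP; have := omR (e_ i + e_ j).
  under eq_bigr => l _ do rewrite mxE scalerDl.
  by rewrite big_split /= !sum_delta cvDl !cvD !om_ii add0r addr0.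
(* the coefficient of [of_coord q c] at K is read on om_i for a chosen i in K *)
have etaE j : cv (e_ j) (of_coord q c) = om j.
  apply/ffunP => I; rewrite cv_delta; case: ifPn => [jI|jI].
    have /ffunP/(_ (I :\ j)) := om_ii j; rewrite cv_delta setD11 setD1K // ext0.
    by move/(congr1 ( *%R (sg k j (I :\ j)))); rewrite mulrA sg_sq mul1r mulr0.
  rewrite [of_coord _ _ _]ffunE cardsU1 jI eqSS; case: (eqVneq #|I| q) => [cI|cI]; last first.
    by rewrite mulr0 om_degree.
  have := some_eltP (setU11 j I); rewrite /kappa; set i := some_elt _ => iK.
  rewrite -[c _ _]/((fun L => c 0 (cidx L i)) _).
  have -> L : (fun L => c 0 (cidx L i)) L = om i L by rewrite ffunE.
  have [ij|ij] := eqVneq i j; first by rewrite ij setU1K // mulrA sg_sq mul1r.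
  have iI : i \in I by move: iK; rewrite in_setU1 (negPf ij).
  pose I' := I :\ i; have IE : I = i |: I' by rewrite setD1K.
  have iI' : i \notin I' by rewrite setD11.
  have jI' : j \notin I' by rewrite !inE negb_and jI orbT.
  have -> : (j |: I) :\ i = j |: I'.
    by apply/setP => l; rewrite !inE; case: (eqVneq l i) => // ->; rewrite (negPf ij).
  have /ffunP/(_ I') := om_ij i j; rewrite extN !cv_delta (negPf iI') (negPf jI').
  rewrite -IE => H; rewrite IE.
  have := @sg_anti k n.+1 j i I' jI' iI' _; rewrite eq_sym => /(_ ij) sE.
  transitivity (sg k j (i |: I') * (sg k i I' * sg k i I') * sg k i (j |: I') * om i (j |: I')).
    by rewrite sg_sq mulr1 mulrA.
  rewrite mulrA sE !mulNr -mulrA.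
  transitivity (sg k i (j |: I') * sg k i (j |: I') * sg k i I' * - (sg k j I' * om i (j |: I'))).
    by ring.
  by rewrite -H sg_sq mul1r mulrA sg_sq mul1r IE.
apply/rowP => l; rewrite [RHS]mxE.
case: (enum_val l) (enum_valK l) => I mu /= <-.
have [mu1|mu1] := eqVneq (mdeg mu) 1%N; last first.
  rewrite c_nonlin // big1 // => i _; case: eqP => // E.
  by rewrite E mdeg1 in mu1.
have [i ->] := c_lin mu mu1.
rewrite (bigD1 i) //= eqxx big1 ?addr0 => [|j ji].
  by rewrite etaE ffunE.
by rewrite (inj_eq (@bunit_inj n)) eq_sym (negPf ji).
Qed.

End Forms.

(** * The singular set *)

Section Codim.
Variables (k : closedFieldType) (n : nat).
Implicit Types (x : ext k n.+1).

Lemma codim_ge_eq N (Y Y' : pset k N) r : eq_pset Y Y' -> codim_ge Y r -> codim_ge Y' r.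
Proof.
move=> YY' H Z cZ iZ ZY; apply: H cZ iZ _ => z /ZY; exact: (proj2 (YY' z)).
Qed.

(** A chain above an irreducible closed subset Z of the linear space M: if Z is
    all of M it is continued by M + u and M + u + v, otherwise by M and M + u. *)
Lemma linear_codim2 N r (M : 'M[k]_(r, N)) (u v : 'rV[k]_N) :
  (forall a b, ((a *: u + b *: v)%R <= M)%MS -> a = 0 /\ b = 0) ->
  codim_ge (linear_pset M) 2.
Proof.
move=> uvM Z cZ iZ ZM.
pose M1 := col_mx M u; pose M2 := col_mx M1 v.
have /andP[sub01 u1] : (M <= M1)%MS && (u <= M1)%MS by rewrite -col_mx_sub submx_refl.
have /andP[sub12 v2] : (M1 <= M2)%MS && (v <= M2)%MS by rewrite -col_mx_sub submx_refl.
have nu : ~~ (u <= M)%MS.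
  apply/negP => uM; have := uvM 1 0; rewrite scale1r scale0r addr0 => /(_ uM)[/eqP].
  by rewrite oner_eq0.
have nv : ~~ (v <= M1)%MS.
  apply/negP => vM1; have : (v <= M + u)%MS by rewrite addsmxE.
  case/sub_addsmxP=> [[a b]] /= E.
  have [|_ /eqP] := uvM (- b 0 0) 1; last by rewrite oner_eq0.
  rewrite scale1r E [b]mx11_scalar mul_scalar_mx scaleNr mxE eqxx mulr1n addrCA addNr addr0.
  exact: submxMl.
have u0 : u != 0 by apply: contraNneq nu => ->; apply: sub0mx.
have v0 : v != 0 by apply: contraNneq nv => ->; apply: sub0mx.
have M10 : M1 != 0 by apply: contraNneq u0 => E; move: u1; rewrite E => /submx0null ->.
have M20 : M2 != 0 by apply: contraNneq v0 => E; move: v2; rewrite E => /submx0null ->.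
have step s t (P : 'M[k]_(s, N)) (Q : 'M[k]_(t, N)) (w : 'rV[k]_N) : w != 0 ->
    (P <= Q)%MS -> (w <= Q)%MS -> ~~ (w <= P)%MS ->
    sub_pset (linear_pset P) (linear_pset Q) /\ ~ sub_pset (linear_pset Q) (linear_pset P).
  move=> w0 PQ wQ wP; split=> [y [y0 yP]|H]; first by split=> //; apply: submx_trans PQ.
  by have [_] := H w (conj w0 wQ); apply/negP.
have [MZ|nMZ] := classic (sub_pset (linear_pset M) Z).
  exists (fun i => if i is i'.+1 then
    (if i' is _.+1 then linear_pset M2 else linear_pset M1) else Z); split => //.
    case=> [//|[|[|//]]] _; split; by [apply: linear_pset_closed | apply: linear_pset_irreducible].
  case=> [|[|//]] _; last exact: step v0 sub12 v2 nv.
  have [s1 s2] := step _ _ _ _ _ u0 sub01 u1 nu.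
  by split=> [y /ZM/s1 // | H]; apply: s2 => y /H/ZM.
have M0 : M != 0.
  have [[z Zz] _] := iZ; have [z0 zM] := ZM z Zz.
  by apply: contraNneq z0 => E; move: zM; rewrite E => /submx0null ->.
exists (fun i => if i is i'.+1 then
  (if i' is _.+1 then linear_pset M1 else linear_pset M) else Z); split => //.
  case=> [//|[|[|//]]] _; split; by [apply: linear_pset_closed | apply: linear_pset_irreducible].
case=> [|[|//]] _; last exact: step u0 sub01 u1 nu.
by split.
Qed.

(** The singular set consists of the x with i_x eta = 0, a linear space.  If a and
    b are distinct elements of a set J with eta_J <> 0, this space meets the plane
    spanned by e_a and e_b only in 0, since the contraction of eta by
    s e_a + t e_b has the coefficients s eta_J and t eta_J, up to sign. *)
Lemma codim_sing p x : (1 < p)%N -> of_degree p x -> x != 0 ->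
  codim_ge (sing (radial_form x)) 2.
Proof.
move=> p1 xp /ext_neq0[J xJ].
have cJ : #|J| = p by apply/eqP; apply: contraNT xJ => /xp ->.
have [a aJ] : exists a, a \in J by apply/set0Pn; rewrite -card_gt0 cJ ltnW.
have [b bJ] : exists b, b \in J :\ a.
  by apply/set0Pn; rewrite -card_gt0 -ltnS; move: p1; rewrite -cJ (cardsD1 a J) aJ.
pose P : 'M[k]_(n.+1, #|{: {set 'I_n.+1}}|) :=
  \matrix_(i, j) cv (e_ i) x (enum_val j).
have PE (z : 'rV[k]_n.+1) : (z <= kermx P)%MS <-> cv z x = 0.
  have zP j : (z *m P) 0 j = cv z x (enum_val j).
    rewrite mxE cv_expand sum_ffunE; apply: eq_bigr => i _.
    by rewrite extZ mxE.
  rewrite (sameP sub_kermxP eqP); split=> [/eqP H|H].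
    by apply/ffunP => K; rewrite ext0 -(enum_rankK K) -zP H mxE.
  by apply/eqP/rowP => j; rewrite zP H ext0 mxE.
have singE : eq_pset (linear_pset (kermx P)) (sing (radial_form x)).
  move=> z; split=> [][z0 H]; split=> //.
    move=> I; have /ffunP/(_ I) := meval_radial_form z x.
    by rewrite map_extE /= => ->; rewrite (proj1 (PE z) H) ext0.
  apply/PE/ffunP => I; rewrite ext0 -(H I) -meval_radial_form map_extE.
  by [].
apply: codim_ge_eq singE _; apply: (@linear_codim2 _ _ _ (e_ a) (e_ b)) => s t.
move/PE; rewrite cvDl !cvZl.
have /setD1P[ba bJ'] := bJ.
have unit_sg i (K : {set 'I_n.+1}) c : c * (sg k i K * x J) = 0 -> c = 0.
  by move/eqP; rewrite !mulf_eq0 (negPf xJ) signr_eq0 !orbF => /eqP.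
move=> H; split.
  have /ffunP/(_ (J :\ a)) := H; rewrite extD !extZ ext0 !cv_delta setD11 bJ.
  by rewrite setD1K // mulr0 addr0 => /unit_sg.
have /ffunP/(_ (J :\ b)) := H; rewrite extD !extZ ext0 !cv_delta setD11.
by rewrite !inE eq_sym ba aJ setD1K // mulr0 add0r => /unit_sg.
Qed.

End Codim.

(** * The equations of foliations *)

Section Foliations.
Variables (k : closedFieldType) (n : nat).
Local Notation N := #|{: Defs.coord n 0}|.
Implicit Types (x : ext k n.+1) (c : 'rV[k]_N) (J : {set 'I_n.+1}).
Local Notation const := (map_ext (@mpolyC n.+1 k)).
Local Notation rad := (radial k n).

Lemma ext_const_basis J : ext_const (ebasis k J) = ebasis {mpoly k[n.+1]} J.
Proof. by apply/ffunP => K; rewrite !ffunE; case: eqP. Qed.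

Lemma ext_d_radial_form p x : of_degree p x -> ext_d (radial_form x) = p%:R *: const x.
Proof.
move=> xp; apply/ffunP => K; rewrite ffunE extZ map_extE.
transitivity (\sum_(i in K) (x K)%:MP_[n.+1] : {mpoly k[n.+1]}).
  apply: eq_bigr => i iK; rewrite radial_formE raddf_sum /= (bigD1 i) //= big1 ?addr0.
    rewrite mderivZ mderivX mnm1E eqxx scale1r.
    have -> : (U_(i) - U_(i))%MM = 0%MM :> 'X_{1..n.+1}.
      by apply/mnmP => l; rewrite mnmBE subnn mnm0E.
    rewrite mpolyX0 cv_delta setD11 setD1K // -mul_mpolyC mulr1 mpolyCM mulrA.
    rewrite -[(-1) ^+ _]/(sg _ i (K :\ i)).
    have -> : (sg k i (K :\ i))%:MP = sg {mpoly k[n.+1]} i (K :\ i) by rewrite /sg rmorph_sign.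
    by rewrite sg_sq mul1r.
  move=> j ji; rewrite mderivZ mderivX mnm1E (negPf ji) scale0r scaler0.
  by [].
rewrite sumr_const; have [<-|/xp ->] := eqVneq #|K| p; first by rewrite mulr_natl.
by rewrite mpolyC0 mulr0 mul0rn.
Qed.

Definition integrable q (w : pform k n) :=
  (forall v, of_degree q.-1 v -> wedge (contr (ext_const v) w) w = 0) /\
  (forall v, of_degree q.-1 v -> wedge (contr (ext_const v) w) (ext_d w) = 0).

Lemma integrable_basis q x : (0 < q)%N -> of_degree q.+1 x ->
  (forall J, #|J| = q.-1 -> let u := oneform (cJ J (radial_form x)) in
     ev u (radial_form x) = 0 /\ ev u (q.+1%:R *: const x) = 0) <->
  integrable q (radial_form x).
Proof.
move=> q0 xq; have wq := radial_form_degree xq.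
have d1 J : #|J| = q.-1 -> of_degree 1 (cJ J (radial_form x)).
  by move=> cardJ; apply: cJ_degree; rewrite cardJ addn1 prednK.
rewrite /integrable (ext_d_radial_form xq); split=> [H|[H1 H2] J cardJ /=].
  have W y v : of_degree q.-1 v -> 
    (forall J, #|J| = q.-1 -> ev (oneform (cJ J (radial_form x))) y = 0) ->
    wedge (contr (ext_const v) (radial_form x)) y = 0.
    move=> vq Hy; rewrite contr_ebasis wedge_suml big1 // => J _.
    have [cardJ|cardJ] := eqVneq #|J| q.-1; last by rewrite ffunE vq // mpolyC0 scale0r.
    by rewrite wedge_oneform ?Hy ?scaler0 //; apply: d1.
  by split=> v vq; apply: W => // J /H[].
have bJ : of_degree q.-1 (ebasis k J).
  by move=> K Kq; rewrite ffunE; case: eqP => // E; rewrite E cardJ eqxx in Kq.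
have := H1 _ bJ; have := H2 _ bJ; rewrite ext_const_basis -/(cJ _ _).
by rewrite !(wedge_oneform _ (d1 J cardJ)); split.
Qed.

(** A contraction of i_R eta of degree 1 is, up to sign, u = i_R c for a contraction
    c of eta of degree 2.  It is a combination of one-forms i_(e_J) eta, which kill
    eta; and u ^ i_R eta = <u, R> eta - i_R (u ^ eta), where <u, R> = i_R i_R c = 0. *)
Lemma plucker_integrable q x : (0 < q)%N -> of_degree q.+1 x -> plucker q.+1 x ->
  integrable q (radial_form x).
Proof.
move=> q0 xq Px; apply/integrable_basis => // J cardJ /=.
have Pc := map_ext_plucker (@mpolyC n.+1 k) Px.
rewrite {1 3}/radial_form cJ_cv oneformZ !evZl.
set u := oneform _.
have ux : ev u (const x) = 0.
  rewrite /u cv_expand oneform_sum ev_suml big1 // => i _.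
  have [iJ|iJ] := boolP (i \in J).
    by rewrite cv_cJ_in // oneform0 ev0l scaler0.
  rewrite cv_cJ // oneformZ evZl Pc ?scaler0 //.
  by rewrite cardsU1 iJ cardJ add1n prednK.
have u1 : of_degree 1 (cv rad (cJ J (const x))).
  apply: cv_degree; apply: cJ_degree; rewrite cardJ addn2 prednK //.
  exact: map_ext_degree.
have uR : pairing u rad = 0.
  by apply: (@ext1_eq _ n.+1); rewrite -cv_oneform // cv_sq scale0r.
by rewrite /radial_form ev_cv uR ux cv0 scale0r subrr evZ ux !scaler0.
Qed.

(** Here omega is a one-form, so that omega ^ omega = 0, and d omega = 2 eta = 0. *)
Lemma char2_integrable x : 2%:R = 0 :> k -> of_degree 2 x ->
  integrable 1 (radial_form x).
Proof.
move=> c2 x2; apply/integrable_basis => // J /eqP; rewrite cards_eq0 => /eqP -> /=.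
rewrite cJ0; set w := radial_form x.
have w1 : of_degree 1 w by exact: radial_form_degree.
split; first by rewrite -{2}(vec_oneform w1) -ev_ext1 ev_sq.
by rewrite -(rmorph_nat (@mpolyC n.+1 k)) c2 rmorph0 scale0r ev0.
Qed.

(** For q = 1 the equation omega ^ d omega = 0 is 2 (i_x eta) ^ eta = 0 at the point
    x.  For q > 1 the equations that do not involve d omega say that i_x eta
    satisfies the Pluecker relations for all x. *)
Lemma integrable_plucker q x : (0 < q)%N -> 2%:R != 0 :> k \/ (1 < q)%N ->
  of_degree q.+1 x -> integrable q (radial_form x) -> plucker q.+1 x.
Proof.
move=> q0 hq xq /(integrable_basis q0 xq) H.
have {}H J (a : 'rV[k]_n.+1) : #|J| = q.-1 ->
    ev (oneform (cJ J (cv a x))) (cv a x) = 0 /\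
    q.+1%:R *: ev (oneform (cJ J (cv a x))) x = 0.
  move=> /H[H1 H2].
  have E0 : map_ext (meval (a 0)) 0 = 0 :> ext k n.+1.
    by apply/ffunP => K; rewrite map_extE !ext0 rmorph0.
  have Ex : map_ext (meval (a 0)) (q.+1%:R *: const x) = q.+1%:R *: x.
    apply/ffunP => K; rewrite map_extE !extZ rmorphM rmorph_nat /= map_extE.
    by rewrite mevalC.
  have := congr1 (map_ext (meval (a 0))) H1; have := congr1 (map_ext (meval (a 0))) H2.
  rewrite !map_ext_ev -map_oneform map_ext_cJ meval_radial_form Ex E0.
  by rewrite evZ.
case: q => [//|[|r]] in q0 hq xq H *.
  case: hq => // c2 J [cJ]; have /cards1P[i ->] : #|J| == 1%N by rewrite cJ.
  have [//|_] := H set0 (e_ i); first by rewrite cards0.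
  rewrite cJ0 => /eqP; rewrite scaler_eq0 (negPf c2) => /eqP E.
  have := cv_cJ x (negbT (in_set0 i)); rewrite cJ0 inversions0l scale1r setU0.
  by move=> <-.
apply: plucker_of_contractions => // B cB v.
have [|E _] := H B v; first by rewrite cB.
move: E; rewrite cJ_cv oneformZ evZl => /eqP.
by rewrite scaler_eq0 signr_eq0 => /eqP.
Qed.

(** The constant forms of degree q + 1 whose contraction by the radial field is
    integrable: for q = 1 in characteristic 2 only the degree is prescribed. *)
Definition fol_form q x := of_degree q.+1 x /\
  ((2%:R != 0 :> k \/ (1 < q)%N) -> plucker q.+1 x).

(** The condition on the singular set holds by [codim_sing], and the equations of
    foliations amount to the Pluecker relations outside the exceptional case. *)
Lemma FolE q c : (0 < q)%N ->
  Fol k n q 0 c <-> [/\ c != 0, c = to_coord (of_coord q c) & fol_form q (of_coord q c)].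
Proof.
move=> q0; split.
  case=> /PH0E[c0 cE] _ H1 H2; split=> //; split=> [|hq]; first exact: of_coord_degree.
  apply: integrable_plucker => //; first exact: of_coord_degree.
  by rewrite -form_of_to_coord -cE; split.
case=> c0 cE [xq Px].
have x0 : of_coord q c != 0 by apply: contraNneq c0 => E; rewrite cE E to_coord0.
have wE : form_of c = radial_form (of_coord q c) by rewrite {1}cE form_of_to_coord.
have [I1 I2] : integrable q (form_of c).
  rewrite wE; have [c2|c2] := eqVneq (2%:R : k) 0; last first.
    by apply: plucker_integrable => //; apply: Px; left.
  have [q1|q1] := ltnP 1 q; first by apply: plucker_integrable => //; apply: Px; right.
  have q1' : q = 1%N by apply/eqP; rewrite eqn_leq q1.
  by move: xq; rewrite q1' => xq; apply: char2_integrable.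
split=> //; first exact/PH0E.
by rewrite wE; apply: (codim_sing _ xq x0).
Qed.

End Foliations.

(** * Degrees and variables of the coefficients *)

(** Homogeneous polynomials of degree d, and polynomials with zero derivative in
    some variable, are two instances of such families.  The closure properties of
    the operations of the exterior algebra are proved for both at once. *)
Record graded_family (A : comNzRingType) (G : nat -> A -> Prop) : Prop := GradedFamily {
  graded0 : forall d, G d 0;
  graded1 : G 0 1;
  gradedD : forall d a b, G d a -> G d b -> G d (a + b);
  gradedN : forall d a, G d a -> G d (- a);
  gradedM : forall d e a b, G d a -> G e b -> G (d + e)%N (a * b) }.

Section Graded.
Variables (A : comNzRingType) (G : nat -> A -> Prop).
Hypothesis gG : graded_family G.

Definition graded_ext m d (x : ext A m) := forall K, G d (x K).
Definition graded_mx m n d (U : 'M[A]_(m, n)) := forall i j, G d (U i j).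

Lemma graded_sign e : G 0 ((-1) ^+ e).
Proof.
rewrite -signr_odd; case: (odd e); rewrite ?expr0 ?expr1; last exact: (graded1 gG).
by apply: (gradedN gG); apply: (graded1 gG).
Qed.

Lemma graded_signM e d a : G d a -> G d ((-1) ^+ e * a).
Proof. by move=> Ga; rewrite -[d]add0n; apply: (gradedM gG) (graded_sign e) Ga. Qed.

Lemma graded_sum (I : finType) (P : pred I) d (F : I -> A) :
  (forall i, P i -> G d (F i)) -> G d (\sum_(i | P i) F i).
Proof. by move=> GF; apply: (big_ind (G d)); [exact: (graded0 gG) | exact: (gradedD gG) |]. Qed.

Lemma graded_ev m d e (u : 'rV[A]_m) x :
  graded_mx d u -> graded_ext e x -> graded_ext (d + e) (ev u x).
Proof.
move=> Gu Gx K; rewrite evE; apply: graded_sum => i _.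
by rewrite -mulrA; apply: graded_signM; apply: (gradedM gG).
Qed.

Lemma graded_cv_delta m d i (x : ext A m) : graded_ext d x -> graded_ext d (cv (e_ i) x).
Proof.
by move=> Gx K; rewrite cv_delta; case: ifP => _; [exact: (graded0 gG) | exact: graded_signM].
Qed.

Lemma graded_cJ m d J (x : ext A m) : graded_ext d x -> graded_ext d (cJ J x).
Proof.
by move=> Gx K; rewrite cJE; case: ifP => _; [exact: graded_signM | exact: (graded0 gG)].
Qed.

Lemma graded_oneform m d (x : ext A m) : graded_ext d x -> graded_mx d (oneform x).
Proof. by move=> Gx i j; rewrite mxE. Qed.

Lemma graded_pl m s d (U : 'M[A]_(s, m)) : graded_mx d U -> graded_ext (s * d) (pl U).
Proof.
suff H (u : 'I_s -> 'rV[A]_m) : (forall a, graded_mx d (u a)) ->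
    graded_ext (s * d) (evs u (ext1 A m)).
  by move=> GU; apply: H => a i j; rewrite mxE.
elim: s u {U} => [|s IH] u Gu.
  rewrite evs0 => K; rewrite ffunE.
  by case: (K == set0); [exact: (graded1 gG) | exact: (graded0 gG)].
by rewrite evsS mulSn; apply: graded_ev => //; apply: IH => a; apply: Gu.
Qed.

Lemma graded_to_coord n d (x : ext A n.+1) : graded_ext d x -> graded_mx d (to_coord x).
Proof.
move=> Gx i j; rewrite mxE; apply: graded_sum => l _.
case: ifP => _; [exact: graded_cv_delta | exact: (graded0 gG)].
Qed.

End Graded.

(** * The generic point *)

Section Generic.
Variables (k : closedFieldType) (n : nat).
Local Notation N := #|{: Defs.coord n 0}|.

(** Forms on the space of coordinates are obtained by applying the constructions
    above to this point, over the ring of polynomials; they are evaluated by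
    change of coefficient ring. *)
Definition generic : 'rV[{mpoly k[N]}]_N := \row_j 'X_j.

Lemma map_generic (y : 'rV[k]_N) : map_mx (meval (y 0)) generic = y.
Proof. by apply/rowP => j; rewrite !mxE mevalXU. Qed.

Lemma map_of_coord_generic q (y : 'rV[k]_N) :
  map_ext (meval (y 0)) (of_coord q generic) = of_coord q y.
Proof. by rewrite map_of_coord map_generic. Qed.

Lemma meval_of_coord q (y : 'rV[k]_N) K : (of_coord q generic K).@[y 0] = of_coord q y K.
Proof. by rewrite -map_of_coord_generic map_extE. Qed.

Lemma meval_to_coord M (x : ext {mpoly k[M]} n.+1) (y : 'rV[k]_M) j :
  (to_coord x 0 j).@[y 0] = to_coord (map_ext (meval (y 0)) x) 0 j.
Proof. by rewrite -map_to_coord [RHS]mxE. Qed.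

Definition homog_grade M d (p : {mpoly k[M]}) : Prop := p \is d.-homog.
Definition free_grade M (l : 'I_M) (d : nat) (p : {mpoly k[M]}) : Prop := mderiv l p = 0.

Lemma homog_graded M : graded_family (@homog_grade M).
Proof.
split=> [d||d p r|d p|d e p r].
- exact: dhomog0.
- exact: dhomog1.
- exact: dhomogD.
- by rewrite /homog_grade dhomogN.
- exact: dhomogM.
Qed.

Lemma free_graded M (l : 'I_M) : graded_family (free_grade l).
Proof.
rewrite /free_grade; split=> [d||d p r pl rl|d p pl|d e p r pl rl].
- exact: mderiv0.
- by rewrite -mpolyC1 mderivC.
- by rewrite mderivD pl rl addr0.
- by rewrite mderivN pl oppr0.
- by rewrite mderivM pl rl mul0r mulr0 addr0.
Qed.

Lemma of_coord_homog q : graded_ext (@homog_grade N) 1 (of_coord q generic).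
Proof.
move=> K; rewrite ffunE; case: ifP => _; last exact: (graded0 (homog_graded N)).
apply: (graded_signM (homog_graded N)).
by rewrite mxE /homog_grade dhomogX /= mdeg1.
Qed.

Lemma of_coord_free q l K : l != kappa K -> mderiv l (of_coord q generic K) = 0.
Proof.
move=> lK; rewrite ffunE; case: ifP => _; last exact: mderiv0.
apply: (@graded_signM _ _ (free_graded l) _ 0%N).
by rewrite mxE /free_grade mderivX mnm1E eq_sym (negPf lK) scale0r.
Qed.

Lemma to_coord_kappa (A : comNzRingType) (x : ext A n.+1) K : K != set0 ->
  to_coord x 0 (kappa K) = sg A (some_elt K) (K :\ some_elt K) * x K.
Proof.
case/set0Pn=> i iK; rewrite to_coord_cidx cv_delta setD11 setD1K //.
exact: some_eltP iK.
Qed.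

Lemma of_coordE (A : comNzRingType) q (c : 'rV[A]_N) (K : {set 'I_n.+1}) : #|K| = q.+1 ->
  of_coord q c K = sg A (some_elt K) (K :\ some_elt K) * c 0 (kappa K).
Proof. by move=> cK; rewrite ffunE cK eqxx. Qed.

End Generic.

(** * Geometry of the space of foliations *)

Section Geometry.
Variables (k : closedFieldType) (n q : nat).
Hypotheses (q0 : (0 < q)%N) (qn : (q < n)%N).
Local Notation N := #|{: Defs.coord n 0}|.
Local Notation Xs := (generic k n).
Implicit Types (x : ext k n.+1) (c y : 'rV[k]_N).

Let cond := (2%:R != 0 :> k) || (1 < q)%N.

Lemma condE : cond <-> (2%:R != 0 :> k) \/ (1 < q)%N.
Proof. by rewrite /cond; split=> [/orP|/orP]. Qed.

Lemma Fol_to_coord x : x != 0 -> fol_form q x -> Fol k n q 0 (to_coord x).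
Proof.
move=> x0 [xq Px]; apply/FolE => //; rewrite to_coordK //; split=> //.
by apply: contraNneq x0 => E; rewrite -(to_coordK xq) E -(scale0r (0 : 'rV_N)) of_coordZ scale0r.
Qed.

Lemma Fol_of_coord c : Fol k n q 0 c -> of_coord q c != 0.
Proof. by case/FolE=> // c0 cE _; apply: contraNneq c0 => E; rewrite cE E to_coord0. Qed.

Lemma Fol_decomposable c : cond -> Fol k n q 0 c -> decomposable q.+1 (of_coord q c).
Proof.
move=> hq Fc; have x0 := Fol_of_coord Fc; case/FolE: Fc => // _ _ [xq Px].
by apply: plucker_decomposable => //; apply: Px; apply/condE.
Qed.

Lemma decomposable_Fol x : decomposable q.+1 x -> Fol k n q 0 (to_coord x).
Proof.
move=> dx; apply: Fol_to_coord; first exact: decomposable_neq0 dx.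
by split=> [|_]; [apply: decomposable_degree | apply: decomposable_plucker].
Qed.

(** The equations are those of the linear space of forms i_R eta and, when they
    apply, the Pluecker relations, which are quadratic. *)
Lemma Fol_closed : zclosed (Fol k n q 0).
Proof.
pose E := of_coord q Xs.
exists (fun p => (exists j, p = 'X_j - to_coord E 0 j) \/
  cond /\ exists (J K : {set 'I_n.+1}), #|J| = q /\ p = ev (oneform (cJ J E)) E K).
  move=> p [[j ->]|[_ [J [K [_ ->]]]]].
    exists 1%N; apply: rpredB; first by rewrite dhomogX /= mdeg1.
    apply: (graded_to_coord (homog_graded k N)); exact: of_coord_homog.
  exists 2%N; apply: (@graded_ev _ _ (homog_graded k N) _ 1%N 1%N); last exact: of_coord_homog.
  apply: graded_oneform; apply: (graded_cJ (homog_graded k N)); exact: of_coord_homog.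
have ev1 y j : ('X_j - to_coord E 0 j).@[y 0] = y 0 j - to_coord (of_coord q y) 0 j.
  by rewrite mevalB mevalXU meval_to_coord map_of_coord_generic.
have ev2 y J K : (ev (oneform (cJ J E)) E K).@[y 0] =
    ev (oneform (cJ J (of_coord q y))) (of_coord q y) K.
  by rewrite -[LHS]map_extE map_ext_ev -map_oneform map_ext_cJ map_of_coord_generic.
move=> y; split=> [/FolE-/(_ q0)[y0 yE [_ Py]]|[y0 H]].
  split=> // p [[j ->]|[/condE hq [J [K [cJ ->]]]]].
    by rewrite ev1 -yE subrr.
  by rewrite ev2 Py ?ext0 // cJ.
apply/FolE => //; split=> //.
  apply/rowP => j; apply/eqP; rewrite -subr_eq0 -ev1; apply/eqP/H.
  by left; exists j.
split=> [|/condE hq J [cJ]]; first exact: of_coord_degree.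
apply/ffunP => K; rewrite ext0 -ev2; apply: H; right; split=> //.
by exists J, K.
Qed.

Lemma Fol_locally_closed : locally_closed (Fol k n q 0).
Proof.
exists (Fol k n q 0), (fun=> False); split; first exact: Fol_closed; last by move=> x; tauto.
exists (eq 1) => [_ <-|x]; first by exists 0%N; apply: dhomog1.
split=> // -[_ /(_ 1 erefl)]; rewrite meval1 => /eqP.
by rewrite oner_eq0.
Qed.

Lemma Fol_nonempty : exists c, Fol k n q 0 c.
Proof.
pose U : 'M[k]_(q.+1, n.+1) := pid_mx q.+1.
have fU : row_free U by rewrite /row_free rank_pid_mx // ltnW.
exists (to_coord (pl U)); apply: decomposable_Fol; exists U => //.
by exists 1; rewrite ?oner_eq0 ?scale1r.
Qed.

(** The Pluecker vectors are parametrized by matrices, and the linear space of the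
    exceptional case by itself. *)
Lemma Fol_irreducible : irreducible (Fol k n q 0).
Proof.
have [hq|hq] := boolP cond.
  pose U : 'M[{mpoly k[q.+1 * n.+1]}]_(q.+1, n.+1) := \matrix_(a, b) 'X_(mxvec_index a b).
  have UE (t : 'rV[k]_(q.+1 * n.+1)) : map_mx (meval (t 0)) U = vec_mx t.
    by apply/matrixP => a b; rewrite !mxE mevalXU.
  apply: (@irreducible_param _ _ _ (fun j => to_coord (pl U) 0 j)); first exact: Fol_nonempty.
  have phiE (t : 'rV[k]_(q.+1 * n.+1)) :
      \row_j (to_coord (pl U) 0 j).@[t 0] = to_coord (pl (vec_mx t)).
    by apply/rowP => j; rewrite [LHS]mxE meval_to_coord map_ext_pl UE.
  move=> c; split=> [Fc|[c0 [t [d d0]]]].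
    have [V _ [d d0 xE]] := Fol_decomposable hq Fc; case/FolE: Fc => // c0 cE _.
    split=> //; exists (mxvec V), d => //.
    by rewrite phiE mxvecK -to_coordZ -xE.
  rewrite phiE -to_coordZ => cE; rewrite cE in c0 *.
  apply: Fol_to_coord; first by apply: contraNneq c0 => ->; rewrite to_coord0.
  split; first by apply: degreeZ; exact: pl_degree.
  by move=> _; apply/pluckerZ/plucker_pl.
apply: (@irreducible_param _ _ _ (fun j => to_coord (of_coord q Xs) 0 j)).
  exact: Fol_nonempty.
have phiE y : \row_j (to_coord (of_coord q Xs) 0 j).@[y 0] = to_coord (of_coord q y).
  by apply/rowP => j; rewrite [LHS]mxE meval_to_coord map_of_coord_generic.
move=> c; split=> [/FolE-/(_ q0)[c0 cE _]|[c0 [t [d d0]]]].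
  by split=> //; exists c, 1; rewrite ?oner_eq0 // phiE scale1r.
rewrite phiE -to_coordZ => cE; rewrite cE in c0 *.
apply: Fol_to_coord; first by apply: contraNneq c0 => ->; rewrite to_coord0.
split; first by apply: degreeZ; exact: of_coord_degree.
by move/condE => hq'; rewrite hq' in hq.
Qed.

(** The sets obtained from J by exchanging at most one element: the coordinates at
    these sets are the entries of the chart at J. *)
Definition neighbour (J K : {set 'I_n.+1}) :=
  (K == J) || [exists i in J, [exists b, (b \notin J) && (K == b |: (J :\ i))]].

(** On the chart h = eta_J <> 0 the form eta is recovered from its coordinates at
    the neighbours of J, by h^q eta = +- pl (chart of eta).  Both sides are
    multiplied by h, so that the equation holds on the whole of X, also where h
    vanishes. *)
Lemma Fol_smooth_decomposable c : cond -> Fol k n q 0 c -> smooth_at (Fol k n q 0) c.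
Proof.
move=> hq Fc; have [J xJ] := ext_neq0 (Fol_of_coord Fc).
have cJ : #|J| = q.+1 by apply/eqP; apply: contraNT xJ => /(@of_coord_degree _ _ _ c) ->.
have [e [E1 E2]] := pl_chart k J.
pose E := of_coord q Xs; pose h := E J.
pose P := h *: ((-1) ^+ e *: pl (chart_mx J E)).
pose D := [set kappa K | K in [pred K | neighbour J K]].
have PE y : map_ext (meval (y 0)) P =
    of_coord q y J *: ((-1) ^+ e *: pl (chart_mx J (of_coord q y))).
  apply/ffunP => K; rewrite map_extE !extZ !rmorphM rmorph_sign /= meval_of_coord.
  congr (_ * (_ * _)); rewrite -[LHS]map_extE map_ext_pl -map_chart_mx.
  by rewrite map_of_coord_generic.
have cK (K : {set 'I_n.+1}) : neighbour J K -> #|K| = q.+1.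
  case/orP=> [/eqP -> //|/existsP[i /andP[iJ /existsP[b /andP[bJ /eqP ->]]]]].
  by rewrite cardsU1 !inE (negPf bJ) andbF -cJ (cardsD1 i J) iJ.
have hE y : h.@[y 0] = of_coord q y J by exact: meval_of_coord.
apply: (@smooth_chart _ _ _ _ h 1 q.+1 (fun j => to_coord P 0 j) D) => //.
- exact: of_coord_homog.
- by rewrite hE.
- move=> j; apply: (graded_to_coord (homog_graded k N)) => K.
  rewrite !extZ mul1n addnC; apply: (gradedM (homog_graded k N)); first exact: of_coord_homog.
  apply: (graded_signM (homog_graded k N)).
  have -> : q.+1 = (#|J| * 1)%N by rewrite muln1 cJ.
  apply: (graded_pl (homog_graded k N)) => a b.
  rewrite !mxE; apply: (graded_signM (homog_graded k N)).
  apply: (graded_cJ (homog_graded k N)).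
  exact: of_coord_homog.
- move=> j /imsetP[K JK ->]; apply: meval_inj => y.
  have K0 : K != set0 by rewrite -card_gt0 cK.
  rewrite meval_to_coord PE to_coord_kappa // mevalM rmorphXn /= hE mevalXU !extZ.
  set t := of_coord q y J; set x := of_coord q y.
  have -> : y 0 (kappa K) = sg k (some_elt K) (K :\ some_elt K) * x K.
    by rewrite /x of_coordE ?cK // mulrA sg_sq mul1r.
  rewrite [RHS]mulrCA; congr (_ * _).
  have EJ : (-1) ^+ e * pl (chart_mx J x) J = x J ^+ q.+1 by rewrite E1 cJ.
  case/orP: JK => [/eqP -> |/existsP[i /andP[iJ /existsP[b /andP[bJ /eqP ->]]]]].
    by rewrite EJ mulrC.
  have := pl_chart_neighbour x iJ bJ; rewrite /= => H.
  by rewrite mulrCA -/t in H *; rewrite H mulrA EJ.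
- move=> l lD; apply: of_coord_free; apply: contraNneq lD => ->.
  by apply: imset_f; rewrite inE /neighbour eqxx.
- have freeE K l : l \notin D -> neighbour J K -> mderiv l (E K) = 0.
    move=> lD JK; apply: of_coord_free; apply: contraNneq lD => ->.
    by apply: imset_f; rewrite inE.
  move=> j l lD.
  suff H : graded_ext (free_grade l) 0 P by exact: (graded_to_coord (free_graded k l) H 0 j).
  move=> K; rewrite !extZ; apply: (@gradedM _ _ (free_graded k l) 0%N 0%N).
    by apply: freeE; rewrite // /neighbour eqxx.
  apply: (graded_signM (free_graded k l)).
  have := @graded_pl _ _ (free_graded k l) _ _ 0%N (chart_mx J E).
  rewrite muln0; apply => a b; rewrite mxE chart_rowE; last exact: enum_valP.
  case: ifP => _; first by apply: freeE; rewrite // /neighbour eqxx.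
  case: ifPn => bJ; first exact: (graded0 (free_graded k l)).
  apply: (graded_signM (free_graded k l)).
  apply: freeE => //; apply/orP; right; apply/existsP; exists (enum_val a).
  by rewrite [_ \in J]enum_valP; apply/existsP; exists b; rewrite bJ eqxx.
- move=> y Fy j; rewrite meval_to_coord PE hE.
  set x := of_coord q y; case/FolE: Fy => // y0 yE [xq Px].
  (* the extra factor h of P settles the points outside the chart *)
  have [xJ0|xJ0] := eqVneq (x J) 0.
    by rewrite xJ0 scale0r to_coord0 exprS !mul0r mxE.
  have H : x J ^+ q.+1 *: x = ((-1) ^+ e * x J) *: pl (chart_mx J x).
    rewrite -[in _ ^+ _]cJ; apply: E2 => [|i iJ]; first by rewrite cJ.
    by apply: ev_chart_row => //; rewrite cJ; apply: Px; apply/condE.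
  rewrite scalerA mulrC -H.
  by rewrite to_coordZ mxE -yE.
- move=> y; have -> : \row_j (to_coord P 0 j).@[y 0] = to_coord (map_ext (meval (y 0)) P).
    by apply/rowP => j; rewrite mxE meval_to_coord.
  rewrite PE => H; apply: Fol_to_coord.
    by apply: contraNneq H => ->; rewrite to_coord0.
  rewrite /fol_form -cJ; split; first by do 2!apply: degreeZ; exact: pl_degree.
  by move=> _; do 2!apply: pluckerZ; exact: plucker_pl.
Qed.

(** In the exceptional case X is a linear space, a graph with h = 1. *)
Lemma Fol_smooth_linear c : ~~ cond -> Fol k n q 0 c -> smooth_at (Fol k n q 0) c.
Proof.
move=> hq Fc; pose E := of_coord q Xs.
pose D : {set 'I_N} := [set kappa K | K in [pred K : {set 'I_n.+1} | #|K| == q.+1]].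
apply: (@smooth_chart _ _ _ _ 1 0 0 (fun j => to_coord E 0 j) D) => //.
- exact: dhomog1.
- by rewrite meval1 oner_eq0.
- move=> j; apply: (graded_to_coord (homog_graded k N)); exact: of_coord_homog.
- move=> _ /imsetP[K /eqP cK ->]; rewrite expr0 mul1r to_coord_kappa; last first.
    by rewrite -card_gt0 cK.
  by rewrite of_coordE // mulrA sg_sq mul1r mxE.
- by move=> l _; rewrite -mpolyC1 mderivC.
- move=> j l lD.
  suff H : graded_ext (free_grade l) 0 E by exact: (graded_to_coord (free_graded k l) H 0 j).
  move=> K.
  have [cK|cK] := eqVneq #|K| q.+1; last by rewrite of_coord_degree //; exact: mderiv0.
  by apply: of_coord_free; apply: contraNneq lD => ->; apply: imset_f; rewrite inE cK.
- move=> y /FolE-/(_ q0)[_ yE _] j.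
  by rewrite meval_to_coord map_of_coord_generic -yE expr0 mul1r.
- move=> y; have -> : \row_j (to_coord E 0 j).@[y 0] = to_coord (of_coord q y).
    by apply/rowP => j; rewrite mxE meval_to_coord map_of_coord_generic.
  move=> H; apply: Fol_to_coord; first by apply: contraNneq H => ->; rewrite to_coord0.
  by split=> [|/condE hq']; [exact: of_coord_degree | rewrite hq' in hq].
Qed.

Lemma Fol_smooth : smooth (Fol k n q 0).
Proof.
move=> c; have [hq|hq] := boolP cond; first exact: Fol_smooth_decomposable.
exact: Fol_smooth_linear.
Qed.

Local Notation M := #|{: {set 'I_n.+1}}|.
Definition row_of x : 'rV[k]_M := \row_i x (enum_val i).
Definition ext_of (z : 'rV[k]_M) : ext k n.+1 := [ffun K => z 0 (enum_rank K)].

Lemma row_ofK x : ext_of (row_of x) = x.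
Proof. by apply/ffunP => K; rewrite ffunE mxE enum_rankK. Qed.
Lemma ext_ofK z : row_of (ext_of z) = z.
Proof. by apply/rowP => i; rewrite mxE ffunE enum_valK. Qed.
Lemma row_ofZ a x : row_of (a *: x) = a *: row_of x.
Proof. by apply/rowP => i; rewrite !mxE extZ. Qed.

Lemma grassmannianE s z :
  grassmannian k n s z <-> decomposable (n.+1 - s) (ext_of z).
Proof.
split=> [[U [fU [c c0 zE]]]|[U fU [c c0 zE]]].
  exists U => //; exists c => //; rewrite zE.
  rewrite -[\row_i _]/(row_of (pl U)) -row_ofZ row_ofK //.
exists U; split=> //; exists c => //.
by rewrite -[\row_i _]/(row_of (pl U)) -row_ofZ -zE ext_ofK.
Qed.

Lemma linear_regular N1 N2 (X : pset k N1) (Y : pset k N2) (f : 'rV[k]_N1 -> 'rV[k]_N2) :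
  {morph f : u v / u + v} -> (forall a u, f (a *: u) = a *: f u) ->
  (forall u, X u -> Y (f u)) -> regular_map X Y f.
Proof.
move=> fD fZ XY; split=> // x _.
have f0 : f 0 = 0 by rewrite -(scale0r 0) fZ scale0r.
exists 1, 1%N, (fun j => linform (fun i => f (e_ i) 0 j)); split.
- by exists 0%N; apply: dhomog1.
- by rewrite meval1 oner_eq0.
- by move=> j; apply: linform_homog.
move=> u _ _; exists 1; rewrite ?oner_eq0 // scale1r; apply/rowP => j.
rewrite mxE meval_linform {2}[u]row_sum_delta (big_morph f fD f0) summxE.
by apply: eq_bigr => i _; rewrite fZ mxE mulrC.
Qed.

(** Hodge duality sends the (q+1)-form with factors U to the multivector of the
    common kernel of these factors, which is the center of the projection.  It is
    linear and has a linear inverse, and so defines regular maps. *)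
Lemma Fol_grassmannian : cond -> isomorphic (Fol k n q 0) (grassmannian k n q.+1).
Proof.
move=> hq; have qn1 : (q.+1 <= n.+1)%N by rewrite ltnW.
exists (fun c => row_of (star (of_coord q c))), (fun z => to_coord (costar (ext_of z))).
split.
- apply: linear_regular => [u v|a u|c Fc].
  + rewrite of_coordD starD; apply/rowP => i; rewrite !mxE; exact: extD.
  + by rewrite of_coordZ starZ row_ofZ.
  + apply/grassmannianE; rewrite row_ofK.
    by apply: star_decomposable => //; apply: Fol_decomposable.
- apply: linear_regular => [u v|a u|z /grassmannianE dz].
  + rewrite -to_coordD -costarD; congr (to_coord (costar _)).
    by apply/ffunP => K; rewrite extD !ffunE mxE.
  + rewrite -to_coordZ -costarZ; congr (to_coord (costar _)).
    by apply/ffunP => K; rewrite extZ !ffunE mxE.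
  + apply: decomposable_Fol.
    by have := costar_decomposable (leq_subr _ _) dz; rewrite subKn.
- move=> c /FolE-/(_ q0)[_ cE _]; exists 1; rewrite ?oner_eq0 // scale1r.
  by rewrite row_ofK starK -cE.
- move=> z /grassmannianE dz; exists 1; rewrite ?oner_eq0 // scale1r.
  have := costar_decomposable (leq_subr _ _) dz; rewrite subKn // => dx.
  by rewrite to_coordK ?costarK ?ext_ofK //; apply: decomposable_degree.
Qed.

(** The projection is given by the factors of eta, and a field v is tangent to the
    foliation when i_v i_x eta = 0 at every point x; [decomposable_cv_cv] computes
    this. *)
Lemma Fol_linear_projection c : cond -> Fol k n q 0 c ->
  defined_by_linear_projection q (form_of c).
Proof.
move=> hq Fc; have [U fU [a a0 xE]] := Fol_decomposable hq Fc.
case/FolE: Fc => // _ cE _.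
exists U^T; first by rewrite mxrank_tr; apply/eqP.
move=> e v _; rewrite /tangent_field cE form_of_to_coord xE -/(cv v _).
pose vE (b : 'rV[k]_n.+1) := decomposable_cv_cv b (map_mx (meval (b 0)) v) fU a0.
have evE (b : 'rV[k]_n.+1) : map_ext (meval (b 0)) (cv v (radial_form (a *: pl U))) =
    cv (map_mx (meval (b 0)) v) (cv b (a *: pl U)).
  by rewrite map_ext_cv meval_radial_form.
split=> [H b|H].
  apply/vE; rewrite -evE H.
  by apply/ffunP => K; rewrite map_extE !ext0 rmorph0.
apply: meval_form_inj => b; rewrite evE; have /vE -> := H b.
by apply/ffunP => K; rewrite map_extE !ext0 rmorph0.
Qed.

End Geometry.

Theorem theorem3p5 (k : closedFieldType) (n q : nat)
    (hn : (3 <= n)%N) (hq : (1 <= q <= n - 1)%N) :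
  [/\ 2%N \notin [pchar k] \/ (1 < q)%N ->
        isomorphic (Fol k n q 0) (grassmannian k n q.+1) /\
        (forall c, Fol k n q 0 c ->
           defined_by_linear_projection q (form_of c)),
      2%N \in [pchar k] -> q = 1%N ->
        eq_pset (Fol k n 1 0) (PH0 k n 1 0) /\
        eq_pset (PH0 k n 1 0) (Cl0 k n) &
      variety (Fol k n q 0) /\ smooth (Fol k n q 0)].
Proof.
have /andP[q0 qn'] := hq.
have qn : (q < n)%N.
  by apply: leq_ltn_trans qn' _; rewrite ltn_subrL /= (leq_trans _ hn).
split=> [char2|char2 q1|].
- have cond : (2%:R != 0 :> k) || (1 < q)%N.
    by case: char2 => [|->]; rewrite ?orbT // inE /= => ->.
  split; first exact: Fol_grassmannian.
  by move=> c; apply: Fol_linear_projection.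
- have c2 : 2%:R = 0 :> k by apply/eqP; move: char2; rewrite inE.
  have FP : eq_pset (Fol k n 1 0) (PH0 k n 1 0).
    move=> c; split=> [[]//|Pc]; apply/FolE => //; have /PH0E[c0 cE] := Pc.
    split=> //; split; first exact: of_coord_degree.
    by rewrite c2 eqxx ltnn; case.
  split=> // c; split=> [Pc|[]//].
  have /FP[_ codim _ _] := Pc; split=> //.
  have /PH0E[_ ->] := Pc; rewrite form_of_to_coord.
  rewrite (ext_d_radial_form (@of_coord_degree _ _ 1 c)).
  rewrite -(rmorph_nat (@mpolyC n.+1 k)) c2 rmorph0 scale0r //.
- split; last exact: Fol_smooth.
  by split; [exact: Fol_locally_closed | exact: Fol_irreducible].
Qed.
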